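(* Let $E\subset\mathbb{R}^N$ be open, $p>1$ and $\gamma>0$. For every pair of positive numbers $\sigma$ and $\tau$ there exist positive constants $C_\sigma$, depending only on $\{p,\gamma,N\}$ and $\sigma$, and $C_\tau$, depending only on $\{p,\gamma,N\}$ and $\tau$, such that for every non-negative function $u\in[DG]_p(E;\gamma)$ and every pair of cubes $K_\rho(y)\subset K_R(y)\subset E$, $$\frac{\sup_{K_\rho(y)}u}{\inf_{K_\rho(y)}u}\le C_\sigma C_\tau\Big(\frac{R}{R-\rho}\Big)^{N\left(\frac1\sigma+\frac1\tau\right)}\Big(\frac{1}{|K_R(y)|}\int_{K_R(y)}u^\sigma\,dx\Big)^{\frac1\sigma}\Big(\frac{1}{|K_R(y)|}\int_{K_R(y)}\frac{1}{u^\tau}\,dx\Big)^{\frac1\tau}.$$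
   Context: For $y\in\mathbb{R}^N$ and $\rho>0$, $K_\rho(y)$ denotes the (axis-parallel) cube of edge $2\rho$ centered at $y$, and $|K_\rho(y)|$ its Lebesgue measure. Pairs of cubes $K_\rho(y)\subset K_R(y)$ have $0<\rho<R$. For a function $w$, $w_+=\max\{w,0\}$ and $w_-=\max\{-w,0\}$; $D$ denotes the weak gradient. Suprema and infima of Sobolev functions are essential ones. DeGiorgi classes: for $p>1$ and a constant $\gamma>0$, $[DG]_p^{\pm}(E;\gamma)$ is the collection of functions $u\in W^{1,p}_{\mathrm{loc}}(E)$ such that $$\int_{K_\rho(y)}|D(u-k)_\pm|^p\,dx\le\frac{\gamma}{(R-\rho)^p}\int_{K_R(y)}|(u-k)_\pm|^p\,dx$$ for all cubes $K_\rho(y)\subset K_R(y)\subset E$ and all $k\in\mathbb{R}$ (upper signs for $[DG]_p^+$, lower signs for $[DG]_p^-$). Moreover $[DG]_p(E;\gamma)=[DG]_p^+(E;\gamma)\cap[DG]_p^-(E;\gamma)$. *)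

(* Defs.v *)
From HB Require Import structures.
From mathcomp Require Import all_boot all_order all_algebra.
From mathcomp Require Import all_classical all_reals all_analysis.
From mathcomp Require Import measurable_realfun ess_sup_inf.

Set Implicit Arguments.
Unset Strict Implicit.
Unset Printing Implicit Defensive.

Import Order.TTheory GRing.Theory Num.Theory.
Import numFieldNormedType.Exports.

Local Open Scope classical_set_scope.
Local Open Scope ring_scope.

Definition rV_display : measure_display -> measure_display.
Proof. exact. Qed.

(* R^n carries the product of the Borel sigma-algebras of its factors (which
   is its Borel sigma-algebra, see [open_measurable_rV]), exactly as
   [n.-tuple R] does in the library. *)
Section rV_measurable.
Context {R : realType}.
Variable n : nat.

Let coors : 'I_n -> 'rV[R]_n -> R := fun i x => x ord0 i.

Let rV_set0 : g_sigma_preimage coors set0.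
Proof. exact: sigma_algebra0. Qed.

Let rV_setC A : g_sigma_preimage coors A -> g_sigma_preimage coors (~` A).
Proof. exact: sigma_algebraC. Qed.

Let rV_bigcup (F : _^nat) : (forall i, g_sigma_preimage coors (F i)) ->
  g_sigma_preimage coors (\bigcup_i (F i)).
Proof. exact: sigma_algebra_bigcup. Qed.

HB.instance Definition _ := @isMeasurable.Build
  (rV_display default_measure_display) 'rV[R]_n (g_sigma_preimage coors) rV_set0 rV_setC rV_bigcup.

End rV_measurable.


Section rV_measurability.
Context {R : realType}.

Lemma measurable_coord n (i : 'I_n) :
  measurable_fun [set: 'rV[R]_n] (fun x => x ord0 i).
Proof.
move=> _ Y mY; rewrite setTI; apply: sub_sigma_algebra => /=.
rewrite -bigcup_seq/=; exists i => /=; first by rewrite mem_index_enum.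
by exists Y => //; rewrite setTI.
Qed.

Lemma measurable_fun_rV d (T : measurableType d) n (f : T -> 'rV[R]_n) :
  (forall i, measurable_fun [set: T] (fun t => f t ord0 i)) ->
  measurable_fun [set: T] f.
Proof.
move=> mf; suff : g_sigma_preimage (fun i t => f t ord0 i) `<=` measurable.
  rewrite (g_sigma_preimage_comp (fun i (x : 'rV[R]_n) => x ord0 i) f) => H.
  by move=> _ A mA; apply: H; exists A.
apply: smallest_sub; first exact: sigma_algebra_measurable.
case: n => [|n] in f mf *; first by rewrite big_ord0.
rewrite -bigcup_mkord_ord; apply: bigcup_sub => i Ii.
by move=> A [B mB <-]; exact: mf.
Qed.

End rV_measurability.

Section rV_cons.
Context {R : realType}.
Variable n : nat.

(* (a, (x_1, ..., x_n)) |-> (a, x_1, ..., x_n), and its inverse *)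
Definition rV_cons (z : measurableTypeR R * 'rV[R]_n) : 'rV[R]_n.+1 :=
  \row_i oapp (fun j => z.2 ord0 j) z.1 (unlift ord0 i).

Definition rV_uncons (v : 'rV[R]_n.+1) : measurableTypeR R * 'rV[R]_n :=
  (v ord0 ord0, \row_j v ord0 (lift ord0 j)).

Lemma rV_consK : cancel rV_cons rV_uncons.
Proof.
case=> a x; congr pair; first by rewrite mxE unlift_none.
by apply/rowP => j; rewrite !mxE liftK.
Qed.

Lemma rV_unconsK : cancel rV_uncons rV_cons.
Proof. by move=> v; apply/rowP => i; rewrite mxE; case: unliftP => [j|] ->//=; rewrite mxE. Qed.

Lemma measurable_rV_cons : measurable_fun [set: _] rV_cons.
Proof.
apply: measurable_fun_rV => i; under eq_fun do rewrite mxE.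
case: (unlift ord0 i) => [j|] /=; last exact: measurable_fst.
by apply: (measurableT_comp (measurable_coord j)).
Qed.

Lemma measurable_rV_uncons : measurable_fun [set: _] rV_uncons.
Proof.
apply/measurable_fun_pairP; split; first exact: measurable_coord.
apply: measurable_fun_rV => i /=; under eq_fun do rewrite mxE.
exact: measurable_coord.
Qed.

HB.instance Definition _ :=
  isMeasurableFun.Build _ _ _ _ rV_cons measurable_rV_cons.

End rV_cons.

Section lebesgue_rV.
Context {R : realType}.
Local Open Scope ereal_scope.

Section step.
Variables (n : nat) (mu : {sigma_finite_measure set 'rV[R]_n -> \bar R}).

Definition lebesgue_cons : set 'rV[R]_n.+1 -> \bar R :=
  pushforward (@lebesgue_measure R \x mu) (@rV_cons R n).

Let lebesgue_cons0 : lebesgue_cons set0 = 0.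
Proof. exact: measure0. Qed.

Let lebesgue_cons_ge0 A : 0 <= lebesgue_cons A.
Proof. exact: measure_ge0. Qed.

Let lebesgue_cons_sigma_additive : semi_sigma_additive lebesgue_cons.
Proof. exact: measure_semi_sigma_additive. Qed.

HB.instance Definition _ := isMeasure.Build _ _ _ lebesgue_cons
  lebesgue_cons0 lebesgue_cons_ge0 lebesgue_cons_sigma_additive.

Let lebesgue_cons_sigma_finite : sigma_finite [set: 'rV[R]_n.+1] lebesgue_cons.
Proof.
have /sigma_finiteP[F [FT ndF Foo]] := sigma_finiteT (@lebesgue_measure R).
have /sigma_finiteP[G [GT ndG Goo]] := sigma_finiteT mu.
exists (fun k => @rV_uncons R n @^-1` (F k `*` G k)) => [|k].
  rewrite -preimage_bigcup (_ : \bigcup_k _ = setT) ?preimage_setT//.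
  rewrite -setXTT FT GT predeqE => -[x y]; split.
    by move=> [k _ [/= Fx Gy]]; split; exists k.
  move=> [/= [i _ Fx] [j _ Gy]]; exists (maxn i j) => //; split.
    by move: x Fx; exact/subsetPset/ndF/leq_maxl.
  by move: y Gy; exact/subsetPset/ndG/leq_maxr.
have [mF Fk] := Foo k; have [mG Gk] := Goo k.
have mFG : measurable (F k `*` G k) by exact: measurableX.
split; first by rewrite -[X in measurable X]setTI; exact: measurable_rV_uncons.
rewrite /lebesgue_cons /pushforward -comp_preimage (_ : _ \o _ = id); last first.
  by apply/funext => z; exact: rV_consK.
by rewrite preimage_id product_measure1E// lte_mul_pinfty// ge0_fin_numE.
Qed.

HB.instance Definition _ := Measure_isSigmaFinite.Build _ _ _ lebesgue_cons
  lebesgue_cons_sigma_finite.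

End step.

(* Lebesgue measure on R^n, as an iterated product *)
Fixpoint lebesgue_rV n : {sigma_finite_measure set 'rV[R]_n -> \bar R} :=
  if n is m.+1 then lebesgue_cons (lebesgue_rV m)
  else \d_ (0%R : 'rV[R]_0).

End lebesgue_rV.

Section cube.
Context {R : realType} {N : nat}.

Definition cube (y : 'rV[R]_N) (r : R) : set 'rV[R]_N :=
  [set x | forall i, `|x ord0 i - y ord0 i| < r].

Lemma measurable_cube y r : measurable (cube y r).
Proof.
rewrite (_ : cube y r = \bigcap_(i in [set: 'I_N])
    (fun x : 'rV[R]_N => x ord0 i) @^-1` ball (y ord0 i) r); last first.
  apply/seteqP; split => [x cx i _|x cx i]; first by rewrite /ball/= distrC.
  by have := cx i Logic.I; rewrite /ball/= distrC.
apply: fin_bigcap_measurable => // i _.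
rewrite -[X in measurable X]setTI; apply: measurable_coord => //.
exact: measurable_ball.
Qed.

Lemma open_measurable_rV (A : set 'rV[R]_N) : open A -> measurable A.
Proof.
move=> oA; pose c (q : 'rV[rat]_N * rat) := cube (map_mx ratr q.1) (ratr q.2).
rewrite (_ : A = \bigcup_q (if pselect (c q `<=` A) then c q else set0)).
  apply: countable_bigcupT_measurable => [|q]; first exact: countableP.
  by case: (pselect _) => ? /=; [exact: measurable_cube|exact: measurable0].
apply/seteqP; split => [x Ax|x [q _]]; last by case: pselect => //= qA /qA.
have /nbhs_ballP[e /= e0 eA] : nbhs x A by exact: open_nbhs_nbhs.
have [s] : exists s, ratr s \in `]0, (e / 2)[.
  by apply: rat_in_itvoo; rewrite divr_gt0.
rewrite in_itv/= => /andP[s0 se].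
have /choice[f fE] (i : 'I_N) :
    exists q, ratr q \in `](x ord0 i - ratr s), (x ord0 i + ratr s)[.
  by apply: rat_in_itvoo; rewrite ltrBlDr -addrA ltrDl addr_gt0.
have xf i : `|x ord0 i - ratr (f i)| < ratr s :> R.
  have := fE i; rewrite in_itv/= => /andP[fi1 fi2].
  by rewrite ltr_distlC fi1 fi2.
exists (\row_i f i, s) => //; case: pselect => [_ i|[]]; first by rewrite /= !mxE.
move=> z cz; apply: eA; split=> // i j; rewrite /ball/= (ord1 i).
have := cz j; rewrite /= !mxE => zj.
have -> : x ord0 j - z ord0 j =
  (x ord0 j - ratr (f j)) + (ratr (f j) - z ord0 j) by rewrite addrA subrK.
rewrite (le_lt_trans (ler_normD _ _))// (splitr e) ltrD// (lt_trans _ se)//.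
by rewrite distrC.
Qed.

End cube.

Lemma lebesgue_rV_cube {R : realType} N (y : 'rV[R]_N) r : 0 < r ->
  lebesgue_rV N (cube y r) = ((r *+ 2) ^+ N)%:E.
Proof.
move=> r0; elim: N y => [|n IHn] y /=.
  by rewrite expr0 diracE mem_set// => -[].
rewrite /lebesgue_cons /pushforward.
rewrite (_ : _ @^-1` _ = (ball (y ord0 ord0 : R) r : set R) `*` cube (rV_uncons y).2 r).
  rewrite product_measure1E//; [|exact: measurable_ball|exact: measurable_cube].
  rewrite exprS EFinM -(IHn (rV_uncons y).2); congr (_ * _)%E.
  exact: lebesgue_measure_ball (ltW r0).
apply/seteqP; split => -[a x] /=.
  move=> cx; split => [|i].
    by have := cx ord0; rewrite mxE unlift_none/= /ball/= distrC.
  by have := cx (lift ord0 i); rewrite !mxE liftK.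
move=> [+ cx] i; rewrite mxE /ball/= distrC.
by case: unliftP => [j|] -> //= _; have := cx j; rewrite mxE.
Qed.

Section weak_gradient.
Context {R : realType} {N : nat}.
Implicit Types (E : set 'rV[R]_N) (u w phi : 'rV[R]_N -> R)
  (g : 'rV[R]_N -> 'rV[R]_N).

(* The norm of the library on ['rV[R]_N] is the sup norm. *)
Definition enorm (v : 'rV[R]_N) : R := Num.sqrt (\sum_i v ord0 i ^+ 2).

Definition partial (i : 'I_N) phi : 'rV[R]_N -> R :=
  fun x => 'D_(delta_mx ord0 i) phi x.

(* C^infty: the iterated partial derivatives of all orders exist and are
   continuous. *)
Definition smooth phi :=
  forall s : seq 'I_N,
    continuous (foldr partial phi s) /\
    forall i x, derivable (foldr partial phi s) x (delta_mx ord0 i).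

Definition test_function E phi :=
  smooth phi /\
  exists K, [/\ compact K, K `<=` E & forall x, ~ K x -> phi x = 0].

Definition Lp_loc (p : R) E u :=
  measurable_fun E u /\
  forall K, compact K -> K `<=` E ->
    (\int[lebesgue_rV N]_(x in K) (`|u x| `^ p)%:E < +oo)%E.

Definition is_weak_gradient E w g :=
  [/\ Lp_loc 1 E w,
      forall i, Lp_loc 1 E (fun x => g x ord0 i) &
      forall phi, test_function E phi -> forall i,
        \int[lebesgue_rV N]_(x in E) (w x * partial i phi x) =
        - \int[lebesgue_rV N]_(x in E) (g x ord0 i * phi x)].

Definition W1p_loc (p : R) E u :=
  Lp_loc p E u /\
  exists2 g, is_weak_gradient E u g &
    forall i, Lp_loc p E (fun x => g x ord0 i).

End weak_gradient.

Section DeGiorgi.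
Context {R : realType} {N : nat}.
Implicit Types (E : set 'rV[R]_N) (u w : 'rV[R]_N -> R) (y : 'rV[R]_N).

(* Weak gradients are unique up to null sets, so the choice of [g] does not
   affect the integrals. *)
Definition Caccioppoli (p gamma : R) E w :=
  exists2 Dw : 'rV[R]_N -> 'rV[R]_N, is_weak_gradient E w Dw &
    forall y (rho r : R), 0 < rho -> rho < r -> cube y r `<=` E ->
      (\int[lebesgue_rV N]_(x in cube y rho) (enorm (Dw x) `^ p)%:E <=
       (gamma / (r - rho) `^ p)%:E *
         \int[lebesgue_rV N]_(x in cube y r) (`|w x| `^ p)%:E)%E.

Definition DG_pos (p gamma : R) E u :=
  W1p_loc p E u /\
  forall k : R, Caccioppoli p gamma E (fun x => u x - k)^\+.

Definition DG_neg (p gamma : R) E u :=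
  W1p_loc p E u /\
  forall k : R, Caccioppoli p gamma E (fun x => u x - k)^\-.

Definition DG (p gamma : R) E u := DG_pos p gamma E u /\ DG_neg p gamma E u.

Definition ess_sup_cube y (r : R) u : \bar R :=
  ess_sup (mrestr (lebesgue_rV N) (measurable_cube y r)) (EFin \o u).

Definition ess_inf_cube y (r : R) u : \bar R :=
  ess_inf (mrestr (lebesgue_rV N) (measurable_cube y r)) (EFin \o u).

Definition avg_cube y (r : R) (f : 'rV[R]_N -> \bar R) : \bar R :=
  ((lebesgue_rV N (cube y r))^-1 * \int[lebesgue_rV N]_(x in cube y r) f x)%E.

End DeGiorgi.

(* Main.v *)
From HB Require Import structures.
Require Import Defs.
From mathcomp Require Import all_boot all_order all_algebra.
From mathcomp Require Import all_classical all_reals all_analysis.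
From mathcomp Require Import measurable_realfun ess_sup_inf.
From mathcomp Require Import ring lra.

Import Order.TTheory GRing.Theory Num.Theory.
Import numFieldNormedType.Exports.

Local Open Scope classical_set_scope.
Local Open Scope ring_scope.

(** The quotient is bounded by estimating the essential supremum and the
    essential infimum separately, each by De Giorgi's iteration.

    The only embedding needed is a Faber-Krahn inequality for functions of
    small support, [faber_krahn]. If w vanishes at x + h for at least half of
    the h in (0, eps)^N, then w x is the increment w x - w (x + h) for all
    these h, so the L^p norm of w is controlled by that of its increments,
    hence by eps times that of its gradient. The increments are reached from
    the definition of the weak gradient by testing it against bumps averaged
    along an axis: this gives
      w (x + h e_i) - w x = int_0^h D_i w (x + t e_i) dt
    for almost every x ([weak_increment_ae]) and then the L^p bound
    ([cube_shift_estimate]).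

    Together with the Caccioppoli inequality, the integral of |w|^p over the
    smaller of two cubes is at most a fixed small multiple of the integral
    over the larger one, as soon as the support of w is small. For truncations
    w_n of u at levels converging geometrically, Chebyshev's inequality for
    w_n bounds the support of w_(n+1), so that the smallness reproduces itself
    and a linear decay at a rate fixed in advance is enough
    ([de_giorgi_iteration]).

    For the supremum and sigma >= p, u^p <= (k / 2)^(p - sigma) u^sigma where
    u > k / 2, so the integral of u^sigma controls the first truncation. For
    sigma < p, u is at least locally bounded; if u <= k B^(j+1) on a cube,
    then u^p <= (k B^(j+1))^(p - sigma) u^sigma there, which yields
    u <= k B^j on a smaller cube. With B^sigma = 2^N this descends from large
    j to u <= k with no loss ([sup_bound_low]). For the infimum it is enough
    that (k - u)^p <= k^(p + tau) u^(-tau) where u < k ([inf_bound]).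

    All iterations run between the two given concentric cubes, so the only
    geometric loss is (r - rho)^N against |K_r| = (2 r)^N, which is the power
    of r / (r - rho) in the statement. *)

Set Implicit Arguments.
Unset Strict Implicit.
Unset Printing Implicit Defensive.

(** * Smooth functions of one variable *)

Section one_variable.
Context {R : realType}.
Implicit Types (f g : R -> R) (x : R) (n : nat).

(** A recursive form of smoothness: it passes to products by induction, without
    a Leibniz formula for iterated derivatives. *)
Fixpoint smooth_upto n f : Prop :=
  if n is m.+1 then
    exists2 f', (forall x, is_derive x 1 f (f' x)) & smooth_upto m f'
  else True.

Definition smooth1 f := forall n, smooth_upto n f.

Lemma smooth_uptoW n f : smooth_upto n.+1 f -> smooth_upto n f.
Proof.
elim: n f => [//|n IH] f [f' df sf]; exists f' => //; exact: IH.
Qed.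

Lemma smooth_uptoD n f g :
  smooth_upto n f -> smooth_upto n g -> smooth_upto n (f \+ g).
Proof.
elim: n f g => [//|n IH] f g [f' df sf] [g' dg sg].
exists (f' \+ g'); last exact: IH.
by move=> x; exact: is_deriveD.
Qed.

Lemma smooth_uptoM n f g :
  smooth_upto n f -> smooth_upto n g -> smooth_upto n (fun x => f x * g x).
Proof.
elim: n f g => [//|n IH] f g sf sg.
have sf' := smooth_uptoW sf; have sg' := smooth_uptoW sg.
case: sf => f' df sf; case: sg => g' dg sg.
exists ((fun x => f x * g' x) \+ (fun x => f' x * g x)).
  move=> x; apply: (@is_derive_eq _ _ _ (f * g)).
  by rewrite addrC /= /GRing.scale/= addrC [g x * _]mulrC.
by apply: smooth_uptoD; exact: IH.
Qed.

Lemma smooth_upto_cst n (c : R) : smooth_upto n (fun=> c).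
Proof.
elim: n c => [//|n IH] c; exists (fun=> 0) => // x; exact: is_derive_cst.
Qed.

Lemma smooth_upto_affine n f (a b : R) :
  smooth_upto n f -> smooth_upto n (fun x => f (a * x + b)).
Proof.
elim: n f => [//|n IH] f [f' df sf].
exists (fun x => a * f' (a * x + b)); last first.
  by apply: smooth_uptoM; [exact: smooth_upto_cst|exact: IH].
move=> x; have da : is_derive x 1 (fun t : R => a * t + b) a.
  apply: (@is_derive_eq _ _ _ ((a \*: id) + cst b)).
  by rewrite addr0 /GRing.scale/= mulr1.
by rewrite mulrC; exact: (@is_derive1_comp _ f (fun t : R => a * t + b)).
Qed.

Lemma smooth1M f g : smooth1 f -> smooth1 g -> smooth1 (fun x => f x * g x).
Proof. by move=> sf sg n; exact: smooth_uptoM. Qed.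

Lemma smooth1_affine f (a b : R) : smooth1 f -> smooth1
  (fun x => f (a * x + b)).
Proof. by move=> sf n; exact: smooth_upto_affine. Qed.

Lemma smooth1_is_derive f x : smooth1 f -> is_derive x 1 f (derive1 f x).
Proof.
by move=> /(_ 1%N)[f' df _]; rewrite derive1E derive_val.
Qed.

Lemma smooth1_derive1 f : smooth1 f -> smooth1 (derive1 f).
Proof.
move=> sf n; have [f' df sf'] := sf n.+1.
by rewrite (_ : derive1 f = f')//; apply/funext => x;
  rewrite derive1E derive_val.
Qed.

Lemma smooth1_continuous f : smooth1 f -> continuous f.
Proof.
move=> sf x; apply: differentiable_continuous; apply/derivable1_diffP.
by have [] := smooth1_is_derive x sf.
Qed.

Lemma smooth1_antiderivative f g :
  smooth1 g -> (forall x, is_derive x 1 f (g x)) -> smooth1 f.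
Proof. by move=> sg df [//|n]; exists g. Qed.

(** The powers of x in the denominator make the family stable under
    differentiation up to linear combinations. *)
Definition flat (m : nat) x := if 0 < x then expR (- x^-1) / x ^+ m else 0.

(** The term of degree m + 2 in the exponential series at 1 / x absorbs the
    pole of order m and leaves a factor x^2, which is what differentiability
    at 0 requires. *)
Lemma flat_le (m : nat) x : `|flat m x| <= m.+2`!%:R * x ^+ 2.
Proof.
rewrite /flat; case: ltP => x0; last first.
  by rewrite normr0 mulr_ge0// ?sqr_ge0.
rewrite ger0_norm ?divr_ge0 ?expR_ge0 ?exprn_ge0 ?(ltW x0)//.
rewrite ler_pdivrMr ?exprn_gt0// -mulrA -exprD expRN.
have y0 : 0 <= x^-1 by rewrite invr_ge0 ltW.
have := @expR_ge1Dxn R _ m.+1 y0.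
have fpos : 0 < (m.+2`!%:R : R) by rewrite ltr0n fact_gt0.
move=> H; have {H} : x^-1 ^+ m.+2 / m.+2`!%:R <= expR x^-1.
  by apply: le_trans H; rewrite lerDr.
rewrite ler_pdivrMr// exprVn => H.
by rewrite -ler_pdivrMr ?exprn_gt0// ler_pdivrMl ?expR_gt0.
Qed.

Lemma is_derive_flat m x :
  is_derive x 1 (flat m) (flat m.+2 x - m%:R * flat m.+1 x).
Proof.
have [x0|x0|<-] := ltgtP 0 x.
- have dpos : is_derive x 1 (fun t => expR (- t^-1) * (t ^+ m)^-1)
      (flat m.+2 x - m%:R * flat m.+1 x).
    have xn0 : x != 0 by rewrite gt_eqF.
    have d1 : is_derive x 1 (fun t : R => - t^-1) (x ^- 2).
      apply: (@is_derive_eq _ _ _ (- (fun t : R => (id t)^-1))).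
        by apply: is_deriveN; apply: is_deriveV.
      by rewrite /GRing.scale/= mulr1 opprK.
    have d2 := @is_derive1_comp _ expR _ _ _ _ (is_derive_expR _) d1.
    have xm0 : (fun t : R => t ^+ m) x != 0 by rewrite /= expf_neq0.
    have d3 : is_derive x 1 (fun t : R => t ^+ m) (m%:R * x ^+ m.-1).
      rewrite (_ : (fun _ => _) = (id : R -> R) ^+ m); last by rewrite exprfctE.
      by apply: is_derive_eq; rewrite /GRing.scale/= mulr1.
    have d4 := @is_deriveV _ (fun t : R => t ^+ m) _ _ _ xm0 d3.
    apply: (@is_derive_eq _ _ _ ((expR \o (fun t : R => - t^-1)) *
      (fun t : R => (t ^+ m)^-1))).
    rewrite /flat x0 /GRing.scale/=.
    clear d1 d2 d3 d4 xm0; case: m => [|k] /=; first by rewrite !expr0; field.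
    by rewrite !exprS; field; rewrite xn0 expf_neq0.
  apply: near_eq_is_derive dpos.
  by near=> t; rewrite /flat ifT//; near: t; exact: lt_nbhsr.
- have f0 k t : t <= 0 -> flat k t = 0 :> R by rewrite /flat ltNge => ->.
  rewrite !f0 ?ltW// mulr0 subr0.
  apply: (@near_eq_is_derive _ _ _ (cst 0)).
  by near=> t; rewrite f0//; apply: ltW; near: t; exact: lt_nbhsl.
- have f0 k : flat k 0 = 0 :> R by rewrite /flat ltxx.
  rewrite !f0 mulr0 subr0.
  have cv : h^-1 *: ((flat m \o shift 0) (h *: 1) - flat m 0) @[h --> (0:R)^']
    --> (0:R).
    apply/cvgrPdist_le => e e0; near=> h.
    have h0 : h != 0 by near: h; exact: nbhs_dnbhs_neq.
    rewrite sub0r normrN f0 subr0 /= addr0 /GRing.scale/= mulr1 normrM normfV.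
    rewrite ler_pdivrMl ?normr_gt0//.
    apply: le_trans (flat_le _ _) _.
    rewrite -real_normK ?num_real// expr2 mulrCA ler_wpM2l//.
    rewrite -ler_pdivlMl ?ltr0n ?fact_gt0//.
    by near: h; apply: dnbhs0_le; rewrite mulr_gt0// invr_gt0 ltr0n fact_gt0.
  by apply: DeriveDef; [apply/cvg_ex; exists 0|apply/cvg_lim].
Unshelve. all: by end_near. Qed.

Lemma flat_smooth m : smooth1 (flat m).
Proof.
move=> n; elim: n m => [//|n IH] m.
exists (fun x => flat m.+2 x + (- m%:R) * flat m.+1 x).
  by move=> x; rewrite mulNr; exact: is_derive_flat.
by apply: smooth_uptoD => //; apply: smooth_uptoM => //; exact: smooth_upto_cst.
Qed.

End one_variable.

(** * Averages over translates and bumps *)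

Section window.
Context {R : realType}.
Implicit Types (f : R -> R) (x : R) (n : nat).
Notation mu := (@lebesgue_measure R).

Lemma window_integral f (F : R -> R) (h x : R) : continuous f ->
  (forall x, is_derive x 1 F (f x)) -> 0 < h ->
  \int[mu]_(t in `[0, h]) f (x - t) = F x - F (x - h).
Proof.
move=> cf dF h0; pose Fx (t : R) := - F (x - t).
have dFx (t : R) : is_derive t 1 Fx (f (x - t)).
  have da : is_derive t 1 (fun t : R => x - t) (- 1).
    apply: (@is_derive_eq _ _ _ (cst x - id)).
    by rewrite sub0r.
  have := @is_derive1_comp _ F (fun t : R => x - t) _ _ _ (dF _) da.
  by move=> /is_deriveN; rewrite mulrN1 opprK.
have cFx : continuous Fx.
  move=> t; apply: differentiable_continuous; apply/derivable1_diffP.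
  by have [] := dFx t.
rewrite /Rintegral (@continuous_FTC2 _ (fun t => f (x - t)) Fx)//.
- by rewrite -EFinB /= /Fx subr0 opprK addrC.
- apply: continuous_subspaceT => t; apply:
    (@continuous_comp _ _ _ (fun t => x - t) f).
    by apply: cvgB; [exact: cvg_cst|exact: cvg_id].
  exact: cf.
- split => [t _||]; first by have [] := dFx t.
  + by apply: cvg_at_right_filter; exact: cFx.
  + by apply: cvg_at_left_filter; exact: cFx.
- by move=> t _; rewrite derive1E; apply: derive_val.
Qed.

(** Averaging over the translates by t in [0, h] turns the derivative into a
    difference of two translates; this is how increments will arise from a
    weak derivative. *)
Lemma smooth1_window f (h : R) : smooth1 f ->
  (forall u, mu.-integrable `]-oo, u] (EFin \o f)) -> 0 < h ->
  let B x := \int[mu]_(t in `[0, h]) f (x - t) in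
  smooth1 B /\ forall x, derive1 B x = f x - f (x - h).
Proof.
move=> sf intf h0 B; have cf := smooth1_continuous sf.
pose F y := \int[mu]_(t in [set` `]-oo, y]]) f t.
have dF x : is_derive x 1 F (f x).
  have xx : x < x + 1 by rewrite ltrDl.
  have [d1 d2] := @continuous_FTC1 _ f -oo%O x (x + 1) xx (intf _) (ltNyr _)
    (cf x).
  by apply: DeriveDef; [exact: d1|rewrite -derive1E; exact: d2].
have BE : B = fun x => F x - F (x - h).
  by apply/funext => x; rewrite /B (window_integral _ cf dF).
have dB x : is_derive x 1 B (f x - f (x - h)).
  rewrite BE.
  have d2 : is_derive x 1 (fun t => F (t - h)) (f (x - h)).
    rewrite -[X in is_derive _ _ _ X]mulr1.
    exact: (@is_derive1_comp _ F (shift (- h)) x _ _ (dF _)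
      (is_derive_shift _ _ _)).
  exact: is_deriveB.
split=> [|x]; last by rewrite derive1E; apply: derive_val.
apply: smooth1_antiderivative dB.
move=> n; rewrite (_ : (fun x => f x - f (x - h)) =
    f \+ (fun x => (fun=> -1) x * (fun x => f (1 * x + - h)) x)); last first.
  by apply/funext => x /=; rewrite mulN1r mul1r.
apply: smooth_uptoD; first exact: sf.
by apply: smooth_uptoM; [exact: smooth_upto_cst|exact: smooth_upto_affine].
Qed.

End window.

Section bumpR.
Context {R : realType}.
Implicit Types (a b x h : R) (n : nat).
Notation mu := (@lebesgue_measure R).

Definition bumpR a b n x :=
  flat 0 (n.+1%:R * (x - a)) * flat 0 (n.+1%:R * (b - x)).

Lemma bumpR_smooth a b n : smooth1 (bumpR a b n).
Proof.
apply: smooth1M.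
  rewrite (_ : (fun x => flat _ _) =
    (fun x => flat 0 (n.+1%:R * x + - (n.+1%:R * a)))); last first.
    by apply/funext => x; rewrite mulrBr.
  by apply: smooth1_affine; exact: flat_smooth.
rewrite (_ : (fun x => flat _ _) =
    (fun x => flat 0 (- n.+1%:R * x + n.+1%:R * b))); last first.
  by apply/funext => x; rewrite mulrBr addrC mulNr.
by apply: smooth1_affine; exact: flat_smooth.
Qed.

Lemma flat0_itv x : 0 <= flat 0 x <= 1.
Proof.
rewrite /flat; case: ltP => x0; last by rewrite lexx ler01.
by rewrite expr0 divr1 expR_ge0 /= -expR0 ler_expR oppr_le0 invr_ge0 ltW.
Qed.

Lemma bumpR_itv a b n x : 0 <= bumpR a b n x <= 1.
Proof.
have /andP[? ?] := flat0_itv (n.+1%:R * (x - a)).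
have /andP[? ?] := flat0_itv (n.+1%:R * (b - x)).
by rewrite mulr_ge0//= mulr_ile1.
Qed.

Lemma bumpR_out a b n x : ~~ (a < x < b) -> bumpR a b n x = 0.
Proof.
rewrite negb_and -!leNgt /bumpR /flat => /orP[xa|xb].
  by rewrite [X in X * _]ifN ?mul0r// -leNgt pmulr_rle0// subr_le0.
by rewrite [X in _ * X]ifN ?mulr0// -leNgt pmulr_rle0// subr_le0.
Qed.

(** [flat 0] tends to 1 at infinity, so the dilations by n.+1 make each factor
    tend to the indicator of a half-line. *)
Lemma bumpR_cvg a b x :
  bumpR a b n x @[n --> \oo] --> ((a < x < b)%R%:R : R).
Proof.
have [axb|naxb] := boolP (a < x < b); last first.
  by under eq_fun do rewrite bumpR_out//; exact: cvg_cst.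
have flat1 y : 0 < y -> flat 0 (n.+1%:R * y) @[n --> \oo] --> (1 : R).
  move=> y0; rewrite /flat.
  under eq_fun do rewrite ifT ?mulr_gt0// expr0 divr1 invfM.
  suff : expR (- (n.+1%:R^-1 * y^-1)) @[n --> \oo] --> expR (- (0 * y^-1)).
    by rewrite mul0r oppr0 expR0.
  apply: (@cvg_comp _ _ _ (fun n : nat => - (n.+1%:R^-1 * y^-1)) (@expR R));
    last exact: continuous_expR.
  by apply: cvgN; apply: cvgMr_tmp; exact: cvg_harmonic.
case/andP: axb => ax xb.
rewrite (_ : true%:R = 1 * 1 :> R); last by rewrite mulr1.
by apply: cvgM; apply: flat1; rewrite subr_gt0.
Qed.

Lemma bumpR_integrable a b n u :
  mu.-integrable `]-oo, u] (EFin \o bumpR a b n).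
Proof.
have mb : measurable_fun setT (bumpR a b n).
  by apply: continuous_measurable_fun; apply: smooth1_continuous;
    exact: bumpR_smooth.
apply: (@le_integrable _ _ _ mu _ _ _ (EFin \o \1_(`]a, b[ : set R))) => //.
- by apply/measurable_EFinP; exact: measurable_funTS.
- move=> x _ /=; rewrite lee_fin; have /andP[b0 b1] := bumpR_itv a b n x.
  rewrite !ger0_norm// indicE.
  have [axb|nax] := boolP (a < x < b); last by rewrite bumpR_out.
  by rewrite mem_set//= in_itv/=.
- by apply: (integrableS measurableT _ _ (integrable_indic_itv a b false true)).
Qed.

End bumpR.

(** * Products of functions of one variable *)

Section tensor.
Context {R : realType} {N : nat}.
Implicit Types (f : 'I_N -> R -> R) (x : 'rV[R]_N).

Definition tensor f x : R := \prod_j f j (x ord0 j).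

Lemma tensor_continuous f :
  (forall j, continuous (f j)) -> continuous (tensor f).
Proof.
move=> cf; rewrite /tensor; elim: (index_enum _) => [|j s IH].
  by under eq_fun do rewrite big_nil; exact: cst_continuous.
under eq_fun do rewrite big_cons.
have cj : continuous (fun x : 'rV[R]_N => f j (x ord0 j)).
  move=> x; apply: (@continuous_comp _ _ _ (fun x : 'rV[R]_N => x ord0 j)
    (f j)).
    exact: coord_continuous.
  exact: cf.
by move=> x; exact: (continuousM (cj x) (IH x)).
Qed.

Definition derive_at f (i j : 'I_N) : R -> R :=
  if j == i then derive1 (f j) else f j.

(** Along the i-th axis only the i-th factor varies, so no product rule for N
    factors is involved. *)
Lemma is_derive_tensor f i x : (forall j, smooth1 (f j)) ->
  is_derive x (delta_mx ord0 i) (tensor f) (tensor (derive_at f i) x).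
Proof.
move=> sf; pose c := \prod_(j | j != i) f j (x ord0 j).
have tE h : tensor f (h *: delta_mx ord0 i + x) = f i (h + x ord0 i) * c.
  rewrite /tensor (bigD1 i)//= !mxE !eqxx mulr1; congr (_ * _).
  by apply: eq_bigr => j ji; rewrite !mxE (negbTE ji) andbF mulr0 add0r.
have tE0 : tensor f x = f i (x ord0 i) * c by rewrite /tensor (bigD1 i).
have [df dv] := smooth1_is_derive (x ord0 i) (sf i).
have cv : h^-1 *: ((tensor f \o shift x) (h *: delta_mx ord0 i) - tensor f x)
    @[h --> 0^'] --> tensor (derive_at f i) x.
  rewrite (_ : tensor (derive_at f i) x = derive1 (f i) (x ord0 i) * c);
    last first.
    rewrite /tensor (bigD1 i)//= /derive_at eqxx; congr (_ * _).
    by apply: eq_bigr => j ji; rewrite (negbTE ji).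
  rewrite (_ : (fun h => _) = (fun h =>
     (h^-1 *: ((f i \o shift (x ord0 i)) (h *: 1) - f i (x ord0 i))) * c));
       last first.
    apply/funext => h /=; rewrite tE tE0 -mulrBl /GRing.scale/= mulr1.
    by rewrite mulrA.
  by apply: cvgMr_tmp; rewrite derive1E; exact: df.
by apply: DeriveDef; [apply/cvg_ex; eexists; exact: cv|apply/cvg_lim].
Qed.

Lemma partial_tensor f i : (forall j, smooth1 (f j)) ->
  partial i (tensor f) = tensor (derive_at f i).
Proof.
by move=> sf; apply/funext => x; have [_ <-] := is_derive_tensor i x sf.
Qed.

Lemma smooth_tensor f : (forall j, smooth1 (f j)) -> smooth (tensor f).
Proof.
move=> sf s.
have [g sg ->] : exists2 g, forall j, smooth1 (g j) &
    foldr partial (tensor f) s = tensor g.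
  elim: s => [|i s [g sg IH]]; first by exists f.
  exists (derive_at g i); last by rewrite /= IH partial_tensor.
  move=> j; rewrite /derive_at; case: ifP => // _; exact: smooth1_derive1.
split; first by apply: tensor_continuous => j; exact: smooth1_continuous.
by move=> i x; have [] := is_derive_tensor i x sg.
Qed.

Definition closed_box (a b : 'rV[R]_N) : set 'rV[R]_N :=
  [set x | forall j, a ord0 j <= x ord0 j <= b ord0 j].

Lemma compact_closed_box a b : compact (closed_box a b).
Proof.
have := @rV_compact R N (fun j => `[a ord0 j, b ord0 j]%classic).
rewrite (_ : [set v | _] = closed_box a b).
  by apply=> j; exact: segment_compact.
by apply/seteqP; split => x /= xab j; have := xab j; rewrite in_itv.
Qed.

Lemma tensor_test_function (E : set 'rV[R]_N) f (a b : 'rV[R]_N) :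
  (forall j, smooth1 (f j)) ->
  (forall j t, ~~ (a ord0 j <= t <= b ord0 j) -> f j t = 0) ->
  closed_box a b `<=` E -> test_function E (tensor f).
Proof.
move=> sf f0 abE; split; first exact: smooth_tensor.
exists (closed_box a b); split=> //; first exact: compact_closed_box.
move=> x /existsNP[j /negP xj]; apply/eqP; rewrite prodf_seq_eq0.
by apply/hasP; exists j; rewrite ?mem_index_enum//= f0.
Qed.

Lemma measurable_tensor f : (forall j, measurable_fun setT (f j)) ->
  measurable_fun setT (tensor f).
Proof.
move=> mf; apply: measurable_prod => j _.
by apply: (measurableT_comp (mf j)); exact: measurable_coord.
Qed.

End tensor.

(** * Translation invariance of the Lebesgue measure *)

Section translation.
Context {R : realType}.

Definition translate {n} (v x : 'rV[R]_n) := x + v.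

Lemma measurable_translate n (v : 'rV[R]_n) :
  measurable_fun setT (translate v).
Proof.
apply: measurable_fun_rV => i; rewrite /translate.
under eq_fun do rewrite mxE.
by apply: measurable_funD => //; exact: measurable_coord.
Qed.

HB.instance Definition _ n (v : 'rV[R]_n) :=
  isMeasurableFun.Build _ _ _ _ (translate v) (measurable_translate v).

Definition shiftR (c x : measurableTypeR R) : measurableTypeR R := x + c.

Lemma measurable_shiftR c : measurable_fun setT (shiftR c).
Proof. exact: measurable_funD. Qed.

HB.instance Definition _ c :=
  isMeasurableFun.Build _ _ _ _ (shiftR c) (measurable_shiftR c).

Lemma lebesgue_measure_shiftR (c : R) A : measurable A ->
  lebesgue_measure (shiftR c @^-1` A) = lebesgue_measure A.
Proof.
move=> mA; apply/esym.
apply: (@lebesgue_measure_unique R (pushforward lebesgue_measure (shiftR c)))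
  => //.
move=> _ [[a b] _ <-]; rewrite /pushforward/=.
transitivity (lebesgue_measure `]a - c, b - c]%classic); last first.
  congr lebesgue_measure.
  by apply/seteqP; split=> x /=; rewrite !in_itv/= /shiftR ltrBlDr lerBrDr.
rewrite !lebesgue_measure_itv/= !lte_fin ltrD2r; case: ifP => // _.
by rewrite -!EFinD opprB addrA subrK.
Qed.

Definition shiftX n (v : 'rV[R]_n.+1) (z : measurableTypeR R * 'rV[R]_n) :=
  (shiftR (v ord0 ord0) z.1, translate (rV_uncons v).2 z.2).

Lemma measurable_shiftX n v : measurable_fun setT (@shiftX n v).
Proof.
apply/measurable_fun_pairP; split.
  exact: (measurableT_comp (measurable_shiftR _) measurable_fst).
exact: (measurableT_comp (measurable_translate _) measurable_snd).
Qed.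

HB.instance Definition _ n v :=
  isMeasurableFun.Build _ _ _ _ (@shiftX n v) (measurable_shiftX v).

(** A product measure is determined by its values on rectangles, where the
    claim splits into the one for the line and the one in lower dimension. *)
Lemma lebesgue_rV_translate n (v : 'rV[R]_n) A : measurable A ->
  lebesgue_rV n (translate v @^-1` A) = lebesgue_rV n A.
Proof.
elim: n v A => [|n IH] v A mA.
  by congr (lebesgue_rV 0 _); apply/seteqP; split => x;
    rewrite /preimage/= /translate;
    rewrite (_ : x + v = x)//; apply/rowP => -[].
rewrite /= /lebesgue_cons /pushforward.
have mA' : measurable (@rV_cons R n @^-1` A).
  by rewrite -[X in measurable X]setTI; exact: measurable_rV_cons.
rewrite (_ : _ @^-1` _ = shiftX v @^-1` (@rV_cons R n @^-1` A)); last first.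
  apply/seteqP; split=> -[t x] /=; rewrite /translate/=;
   (rewrite (_ : _ + v = rV_cons (shiftX v (t, x)))//;
     apply/rowP => i; rewrite !mxE; case: unliftP => [j|] ->/=; rewrite ?mxE//).
apply/esym.
apply: (@product_measure_unique _ _ _ _ _ _ _ (pushforward
  ((@lebesgue_measure R) \x (lebesgue_rV n))%E (shiftX v))) => //.
move=> B C mB mC; rewrite /pushforward.
transitivity ((lebesgue_measure \x lebesgue_rV n)%E
  ((shiftR (v ord0 ord0) @^-1` B) `*` (translate (rV_uncons v).2 @^-1` C))) =>
    //.
rewrite product_measure1E.
- by congr (_ * _)%E; [exact: lebesgue_measure_shiftR|exact: IH].
- by rewrite -[X in measurable X]setTI; exact: measurable_shiftR.
- by rewrite -[X in measurable X]setTI; exact: measurable_translate.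
Qed.

Lemma ge0_integral_translate n (v : 'rV[R]_n) (f : 'rV[R]_n -> \bar R) D :
  measurable D -> measurable_fun D f -> (forall x, 0 <= f x)%E ->
  (\int[lebesgue_rV n]_(x in translate v @^-1` D) f (x + v)%R =
   \int[lebesgue_rV n]_(x in D) f x)%E.
Proof.
move=> mD mf f0.
rewrite -(ge0_integral_pushforward (measurable_translate v) (lebesgue_rV n))//.
by apply: eq_measure_integral => A mA _; exact: lebesgue_rV_translate.
Qed.

Lemma integral_translate n (v : 'rV[R]_n) (f : 'rV[R]_n -> \bar R) :
  measurable_fun setT f ->
  (\int[lebesgue_rV n]_x f (x + v)%R = \int[lebesgue_rV n]_x f x)%E.
Proof.
move=> mf; rewrite integralE [RHS]integralE; congr (_ - _)%E.
  rewrite -[RHS](ge0_integral_translate v)//; last exact: measurable_funepos.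
  by rewrite preimage_setT; under eq_integral do rewrite
    (funepos_comp f (translate v)).
rewrite -[RHS](ge0_integral_translate v)//; last exact: measurable_funeneg.
by rewrite preimage_setT; under eq_integral do rewrite
  (funeneg_comp f (translate v)).
Qed.

End translation.

(** * Integrals along segments *)

Section line_integral.
Context {R : realType} {N : nat}.
Implicit Types (x e v : 'rV[R]_N) (G W phi : 'rV[R]_N -> R).
Notation mu := (lebesgue_rV N).
Notation la := (@lebesgue_measure R).
Local Open Scope ereal_scope.

Lemma integrable_translate v (f : 'rV[R]_N -> \bar R) :
  mu.-integrable setT f -> mu.-integrable setT (fun x => f (x + v)%R).
Proof.
move=> /integrableP[mf foo]; apply/integrableP; split.
  exact: (measurableT_comp mf (measurable_translate v)).
rewrite [ltLHS](_ : _ = \int[mu]_x `|f x|)//.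
rewrite -[RHS](ge0_integral_translate v) ?preimage_setT//.
exact: measurableT_comp.
Qed.

Lemma integrable_bounded_mul (f : 'rV[R]_N -> \bar R) phi :
  mu.-integrable setT f -> measurable_fun setT phi ->
  (forall x, `|phi x| <= 1)%R ->
  mu.-integrable setT (fun x => f x * (phi x)%:E).
Proof.
move=> fi mphi phi1; have mf := measurable_int _ fi.
apply: (le_integrable _ _ _ fi) => //.
  by apply: emeasurable_funM => //; exact/measurable_EFinP.
move=> x _; rewrite abseM -[leRHS]mule1 lee_pmul//=.
by rewrite lee_fin.
Qed.

Lemma measurable_line e :
  measurable_fun setT
    (fun z : 'rV[R]_N * measurableTypeR R => (z.1 + z.2 *: e)%R).
Proof.
apply: measurable_fun_rV => i /=; under eq_fun do rewrite !mxE.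
apply: measurable_funD; last exact: measurable_funM.
exact: (measurableT_comp (measurable_coord i) measurable_fst).
Qed.

(** The values of G on the segment from x to x + h e, extended by 0 to the
    line through it, so that Fubini's theorem applies on the whole space. *)
Definition along G e (h : R) (z : 'rV[R]_N * measurableTypeR R) : \bar R :=
  (G (z.1 + z.2 *: e)%R * \1_(`[0%R, h]) z.2)%:E.

Lemma measurable_indic_snd (h : R) :
  measurable_fun setT (fun z : 'rV[R]_N * measurableTypeR R =>
    \1_(`[0%R, h] : set (measurableTypeR R)) z.2 : R).
Proof.
apply: (@measurableT_comp _ _ _ _ _ _ (\1_(`[0%R, h]) : measurableTypeR R ->
  R)).
  exact: measurable_indic.
exact: measurable_snd.
Qed.

Lemma measurable_along G e h : measurable_fun setT G ->
  measurable_fun setT (along G e h).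
Proof.
move=> mG; apply/measurable_EFinP; apply: measurable_funM.
  exact: (measurableT_comp mG (measurable_line e)).
exact: measurable_indic_snd.
Qed.

Lemma integral_along_abs G e (h : R) : (0 <= h)%R ->
  measurable_fun setT G ->
  \int[la]_t \int[mu]_x `|along G e h (x, t)| = h%:E * \int[mu]_x `|(G x)%:E|.
Proof.
move=> h0 mG.
have mG' : measurable_fun setT (fun x => `|(G x)%:E|).
  by apply: measurableT_comp => //; exact/measurable_EFinP.
transitivity (\int[la]_t ((\int[mu]_x `|(G x)%:E|) *
    (\1_(`[0%R, h] : set (measurableTypeR R)) t)%:E)).
  apply: eq_integral => t _; rewrite /along/=.
  under eq_integral do rewrite normrM EFinM muleC.
  rewrite ge0_integralZl//; last first.
    apply/measurable_EFinP; apply: measurableT_comp => //.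
    exact: (measurableT_comp mG (measurable_translate (t *: e))).
  rewrite muleC ger0_norm//; congr (_ * _).
  rewrite -[RHS](ge0_integral_translate (t *: e)) ?preimage_setT//.
rewrite ge0_integralZl//; last 2 first.
- by apply/measurable_EFinP; exact: measurable_indic.
- exact: integral_ge0.
rewrite integral_indic// setIT muleC; congr (_ * _).
rewrite /= lebesgue_measure_itv/= lte_fin; case: ltP => [_|];
  first by rewrite oppr0 adde0.
by move=> h0'; rewrite (@le_anti _ _ h 0%R)// h0 h0'.
Qed.

Lemma integrable_along G e h : (0 <= h)%R -> mu.-integrable setT (EFin \o G) ->
  (mu \x la).-integrable setT (along G e h).
Proof.
move=> h0 /integrableP[/measurable_EFinP mG Goo].
apply/integrable21ltyP; first exact: measurable_along.
rewrite integral_along_abs// lte_mul_pinfty// ?lee_fin//.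
Qed.

Lemma integrable_bounded_segment (h : R) (f : R -> R) :
  measurable_fun setT f -> (forall t, `|f t| <= 1)%R ->
  la.-integrable `[0%R, h] (EFin \o f).
Proof.
move=> mf f1; apply: measurable_bounded_integrable => //.
- rewrite /= lebesgue_measure_itv/=; case: ifP => // _; exact: ltry.
- exact: measurable_funTS.
- by exists 1%R; split=> // M M1 t _; exact: le_trans (f1 _) (ltW M1).
Qed.

(** Exchanging the integrals and translating by t e moves the average over the
    segment from G to phi. *)
Lemma integral_along_mul G e h phi : (0 <= h)%R ->
  mu.-integrable setT (EFin \o G) ->
  measurable_fun setT phi -> (forall x, `|phi x| <= 1)%R ->
  \int[mu]_x ((\int[la]_t along G e h (x, t)) * (phi x)%:E) =
  \int[mu]_x ((G x)%:E *
     \int[la]_(t in `[0%R, h]) (phi (x - t *: e))%:E).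
Proof.
move=> h0 iG mphi phi1; have [/measurable_EFinP mG Goo] := integrableP _ _ _ iG.
have ia := integrable_along e h0 iG.
have ae := ae_integrable1 ia.
pose K1 (z : 'rV[R]_N * measurableTypeR R) := along G e h z * (phi z.1)%:E.
pose K2 (z : 'rV[R]_N * measurableTypeR R) : \bar R :=
  (G z.1 * phi (z.1 - z.2 *: e)%R * \1_(`[0%R, h]) z.2)%:E.
have mK1 : measurable_fun setT K1.
  apply: emeasurable_funM; first exact: measurable_along.
  by apply/measurable_EFinP; exact: (measurableT_comp mphi measurable_fst).
have iK1 : (mu \x la).-integrable setT K1.
  apply: (le_integrable _ _ _ ia) => //.
  move=> z _; rewrite abseM -[leRHS]mule1 lee_pmul//=.
  by rewrite lee_fin.
have mK2 : measurable_fun setT K2.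
  apply/measurable_EFinP; apply: measurable_funM;
    last exact: measurable_indic_snd.
  apply: measurable_funM; first exact: (measurableT_comp mG measurable_fst).
  apply: (measurableT_comp mphi).
  under eq_fun do rewrite -scalerN.
  exact: (measurable_line (- e)).
have trK (k1 k2 : \bar R -> \bar R) (t : R) : k1 = k2 -> measurable_fun setT k1
  ->
    \int[mu]_x k1 (K1 (x, t)) = \int[mu]_x k2 (K2 (x, t)).
  move=> <- mk.
  rewrite -[RHS](integral_translate (t *: e)); last first.
    apply: (measurableT_comp mk).
    exact: (measurableT_comp mK2 (measurable_pair2 t)).
  apply: eq_integral => x _; rewrite /K1 /K2 /along/= addrK -EFinM.
  by rewrite mulrAC.
have iK2 : (mu \x la).-integrable setT K2.
  apply/integrable21ltyP => //; move/integrable21ltyP : iK1 => /(_ mK1).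
  by under eq_integral do rewrite (trK abse abse)//.
transitivity (\int[mu]_x \int[la]_t K1 (x, t)).
  apply: ae_eq_integral => //.
  - apply: emeasurable_funM; first exact: (measurable_fubini_F ia).
    exact/measurable_EFinP.
  - exact: (measurable_fubini_F iK1).
  - by apply: filterS ae => x ix _; rewrite /K1/= integralZr.
transitivity (\int[mu]_x \int[la]_t K2 (x, t)).
  rewrite (integral12_prod_meas1 iK1) -(integral21_prod_meas1 iK1).
  rewrite [RHS](integral12_prod_meas1 iK2) -(integral21_prod_meas1 iK2).
  by apply: eq_integral => t _; exact: (trK idfun idfun _ erefl
    (@measurable_id _ _ _)).
apply: eq_integral => x _; rewrite /K2/=.
have mphix : measurable_fun setT (fun t : measurableTypeR R => phi
  (x - t *: e)%R).
  apply: (measurableT_comp mphi); apply: measurable_fun_rV => i.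
  under eq_fun do rewrite !mxE.
  by apply: measurable_funB => //; exact: measurable_funM.
rewrite -integralZl//; last first.
  by apply: integrable_bounded_segment => // t; exact: phi1.
rewrite [RHS]integral_mkcond; apply: eq_integral => t _.
rewrite patchE indicE; case: ifPn => _; first by rewrite mulr1 EFinM.
by rewrite mulr0.
Qed.

End line_integral.

(** * Increments from the weak gradient *)

Section weak_increment.
Context {R : realType} {N : nat}.
Implicit Types (x a b e v : 'rV[R]_N) (w : 'rV[R]_N -> R)
  (g : 'rV[R]_N -> 'rV[R]_N) (E Om : set 'rV[R]_N) (i j : 'I_N) (n : nat).
Notation mu := (lebesgue_rV N).
Notation la := (@lebesgue_measure R).
Notation e_ i := (delta_mx ord0 i : 'rV[R]_N).

Definition box_bump a b n : 'rV[R]_N -> R :=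
  tensor (fun j => bumpR (a ord0 j) (b ord0 j) n).

Lemma box_bump_itv a b n x : 0 <= box_bump a b n x <= 1.
Proof.
rewrite /box_bump /tensor; apply/andP; split.
  by apply: prodr_ge0 => j _; have /andP[] := bumpR_itv (a ord0 j) (b ord0 j) n
    (x ord0 j).
by apply: prodr_ile1 => j _; exact: bumpR_itv.
Qed.

Lemma box_bump_le1 a b n x : `|box_bump a b n x| <= 1.
Proof. by have /andP[? ?] := box_bump_itv a b n x; rewrite ger0_norm. Qed.

Lemma measurable_box_bump a b n : measurable_fun setT (box_bump a b n).
Proof.
apply: measurable_tensor => j; apply: continuous_measurable_fun.
by apply: smooth1_continuous; exact: bumpR_smooth.
Qed.

Lemma box_bump_out a b n x : ~ closed_box a b x -> box_bump a b n x = 0.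
Proof.
move=> /existsNP[j /negP xj]; rewrite /box_bump /tensor (bigD1 j)//= bumpR_out
  ?mul0r//.
by apply: contra xj => /andP[? ?]; rewrite !ltW.
Qed.

Lemma box_bump_cvg a b x : box_bump a b n x @[n --> \oo] -->
  (\1_[set z : 'rV[R]_N | forall j, a ord0 j < z ord0 j < b ord0 j] x : R).
Proof.
rewrite (_ : \1_ _ x = \prod_j ((a ord0 j < x ord0 j < b ord0 j)%R%:R : R));
  last first.
  rewrite indicE; have [xab|xab] := pselect
    (forall j, a ord0 j < x ord0 j < b ord0 j).
    by rewrite mem_set// big1// => j _; rewrite xab.
  rewrite memNset//; move/existsNP : xab => [j /negP/negbTE xj].
  by rewrite (bigD1 j)//= xj mul0r.
rewrite /box_bump /tensor; elim: (index_enum _) => [|j s IH].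
  by under eq_fun do rewrite big_nil; rewrite big_nil; exact: cvg_cst.
under eq_fun do rewrite big_cons; rewrite big_cons.
by apply: cvgM => //; exact: bumpR_cvg.
Qed.

(** The weak gradient is tested against psi, the integral over t in [0, h] of
    the translates phi (x - t e_i) of phi = [box_bump a b n]. As the i-th
    partial derivative of psi is phi x - phi (x - h e_i), one side of the weak
    formulation becomes an integral of increments of W and the other one an
    integral of G along segments. Cutting off outside Om, which contains the
    support of psi, makes all the functions globally integrable. *)
Lemma weak_increment_bump E Om w g i (h : R) a b n :
  is_weak_gradient E w g -> Om `<=` E ->
  let W := w \_ Om in let G := (fun x => g x ord0 i) \_ Om in
  mu.-integrable setT (EFin \o W) -> mu.-integrable setT (EFin \o G) ->
  0 < h -> closed_box a b `<=` Om -> closed_box a (b + h *: e_ i) `<=` Om ->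
  (\int[mu]_x ((W (x + h *: e_ i) - W x)%R%:E * (box_bump a b n x)%:E) =
   \int[mu]_x ((\int[la]_t along G (e_ i) h (x, t)) * (box_bump a b n x)%:E))%E.
Proof.
move=> wg OmE W G iW iG h0 abOm abhOm.
set phi := box_bump a b n.
have mphi : measurable_fun setT phi := measurable_box_bump a b n.
have phi1 x : `|phi x| <= 1 := box_bump_le1 a b n x.
pose f j := bumpR (a ord0 j) (b ord0 j) n.
pose B s := \int[la]_(t in `[0, h]) f i (s - t).
have [sB dB] : smooth1 B /\ forall s, derive1 B s = f i s - f i (s - h).
  by apply: smooth1_window => //; [exact: bumpR_smooth|exact: bumpR_integrable].
pose f2 j := if j == i then B else f j.
have sf2 j : smooth1 (f2 j).
  by rewrite /f2; case: ifP => // _; exact: bumpR_smooth.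
have f2out j t : ~~ (a ord0 j <= t <= (b + h *: e_ i) ord0 j) -> f2 j t = 0.
  rewrite !mxE eqxx/= /f2 eq_sym; case: eqVneq => [ij|ij] /=; last first.
    rewrite mulr0 addr0 => tab; rewrite /f bumpR_out//.
    by apply: contra tab => /andP[? ?]; rewrite !ltW.
  rewrite mulr1 -ij => tab; rewrite /B /Rintegral.
  rewrite integral0_eq// => s /=; rewrite in_itv/= => /andP[s0 sh].
  rewrite /f bumpR_out//; apply: contra tab => /andP[st ts].
  by rewrite ij in st ts *; lra.
pose psi := tensor f2.
have tpsi : test_function E psi.
  by apply: (@tensor_test_function _ _ _ _ a (b + h *: e_ i)) => //;
    exact: subset_trans OmE.
have xmij x (t : R) j : (x - t *: e_ i) ord0 j = x ord0 j - t *+ (i == j).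
  by rewrite !mxE eqxx/= eq_sym mulr_natr.
have phiE x (t : R) : phi (x - t *: e_ i) =
    f i (x ord0 i - t) * \prod_(j | j != i) f j (x ord0 j).
  rewrite /phi /box_bump /tensor (bigD1 i)//= xmij eqxx mulr1n; congr (_ * _).
  by apply: eq_bigr => j ji; rewrite xmij eq_sym (negbTE ji) mulr0n subr0.
have dpsi x : partial i psi x = phi x - phi (x - h *: e_ i).
  rewrite partial_tensor//.
  have -> : phi x = phi (x - 0 *: e_ i) by rewrite scale0r subr0.
  rewrite !phiE subr0 -mulrBl -dB /tensor (bigD1 i)//= /derive_at /f2 eqxx.
  by congr (_ * _); apply: eq_bigr => j ji; rewrite (negbTE ji).
have psiE x : (psi x)%:E = (\int[la]_(t in `[0%R, h])
  (phi (x - t *: e_ i))%:E)%E.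
  rewrite /psi /tensor (bigD1 i)//= /f2 eqxx.
  rewrite (eq_bigr (fun j => f j (x ord0 j))); last by move=> j /negbTE ->.
  under eq_integral do rewrite phiE EFinM.
  have ifi : la.-integrable `[0, h] (fun t => (f i (x ord0 i - t))%:E).
    apply: integrable_bounded_segment => [|t].
      apply: (measurableT_comp (f := f i)); last exact: measurable_funB.
      by apply: continuous_measurable_fun; apply: smooth1_continuous;
        exact: bumpR_smooth.
    by have /andP[? ?] := bumpR_itv (a ord0 i) (b ord0 i) n (x ord0 i - t);
      rewrite ger0_norm.
  rewrite integralZr// EFinM; congr (_ * _)%E; rewrite /B /Rintegral fineK//.
  exact: integrable_fin_num.
have psih x : `|psi x| <= h.
  have phi0 y : 0 <= phi y by have /andP[] := box_bump_itv a b n y.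
  have psi0 : 0 <= psi x by rewrite -lee_fin psiE; apply: integral_ge0 => t _;
    rewrite lee_fin.
  rewrite ger0_norm// -lee_fin psiE.
  apply: (@le_trans _ _ (\int[la]_(t in `[0%R, h]) 1)%E).
    apply: ge0_le_integral => // [t _||t _]; rewrite ?lee_fin//.
      apply/measurable_EFinP; apply: measurable_funTS;
        apply: (measurableT_comp mphi).
      by under eq_fun do rewrite -scalerN;
        exact: (measurableT_comp (measurable_line (- e_ i))
        (measurable_pair1 x)).
    by have /andP[] := box_bump_itv a b n (x - t *: e_ i).
  by rewrite integral_cst//= mul1e lebesgue_measure_itv/= lte_fin h0 oppr0
    adde0.
have psiOm x : ~ Om x -> psi x = 0.
  move=> nx.
  have /existsNP[j /negP xj] : ~ closed_box a (b + h *: e_ i) x by move/abhOm.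
  by rewrite /psi /tensor (bigD1 j)//= f2out ?mul0r.
have dpsiOm x : ~ Om x -> partial i psi x = 0.
  move=> nx; rewrite dpsi {1}/phi box_bump_out; last by move/abOm.
  rewrite /phi box_bump_out ?subr0// => xab; apply: nx; apply: abhOm => j.
  have -> : (b + h *: e_ i) ord0 j = b ord0 j + h *+ (i == j).
    by rewrite !mxE eqxx/= eq_sym mulr_natr.
  have := xab j; rewrite xmij => /andP[].
  by case: (i == j); rewrite ?mulr1n ?mulr0n => ? ?; apply/andP; split; lra.
have [_ _ /(_ psi tpsi i)] := wg.
rewrite [in LHS]Rintegral_mkcond [in RHS]Rintegral_mkcond.
rewrite (_ : _ \_ E = (fun x => W x * partial i psi x)); last first.
  apply/funext => x; rewrite /W !patchE.
  have [xOm|xOm] := pselect (Om x); first by rewrite !mem_set//; exact: OmE.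
  by rewrite (memNset xOm) dpsiOm// !mulr0 if_same.
rewrite (_ : _ \_ E = (fun x => G x * psi x)); last first.
  apply/funext => x; rewrite /G !patchE.
  have [xOm|xOm] := pselect (Om x); first by rewrite !mem_set//; exact: OmE.
  by rewrite (memNset xOm) psiOm// !mulr0 if_same.
move=> wgE.
have mphih : measurable_fun setT (fun x => phi (x - h *: e_ i)).
  exact: (measurableT_comp mphi (measurable_translate (- (h *: e_ i)))).
have iWphi : mu.-integrable setT (fun x => (W x)%:E * (phi x)%:E)%E.
  exact: integrable_bounded_mul.
have iWphih : mu.-integrable setT (fun x => (W x)%:E *
  (phi (x - h *: e_ i))%:E)%E.
  exact: integrable_bounded_mul.
have iWh := integrable_translate (h *: e_ i) iW.
have iWhphi : mu.-integrable setT (fun x => (W (x + h *: e_ i)%R)%:E *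
  (phi x)%:E)%E.
  exact: integrable_bounded_mul iWh _ _.
under eq_integral do rewrite EFinB muleBl ?fin_num_adde_defr//.
rewrite integralB//.
rewrite (integral_along_mul (e_ i) (ltW h0) iG mphi phi1).
under [RHS]eq_integral do rewrite -psiE -EFinM.
have -> : (\int[mu]_x ((W (x + h *: e_ i)%R)%:E * (phi x)%:E) =
   \int[mu]_x ((W x)%:E * (phi (x - h *: e_ i))%:E))%E.
  rewrite -[RHS](integral_translate (h *: e_ i));
    last exact: measurable_int iWphih.
  by apply: eq_integral => x _; rewrite addrK.
have iGpsi : mu.-integrable setT (fun x => (G x * psi x)%:E).
  apply: (@le_integrable _ _ _ mu _ _ _ (fun x => h%:E * (G x)%:E)%E) => //.
  - apply/measurable_EFinP; apply: measurable_funM.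
      by have /measurable_EFinP := measurable_int _ iG.
    apply: measurable_tensor => j; apply: continuous_measurable_fun.
    exact: smooth1_continuous.
  - by move=> x _; rewrite -EFinM /= lee_fin !normrM mulrC
      (ger0_norm (ltW h0)) ler_wpM2r.
  - exact: integrableZl.
have := congr1 EFin wgE.
rewrite EFinN /Rintegral !fineK//; last 2 first.
- exact: integrable_fin_num.
- apply: integrable_fin_num => //; apply/(eq_integrable measurableT _ _ _).
    by move=> x _; rewrite dpsi mulrBr EFinB !EFinM.
  exact: integrableB.
rewrite (_ : \int[mu]_x (W x * partial i psi x)%:E =
   \int[mu]_x ((W x)%:E * (phi x)%:E - (W x)%:E * (phi (x - h *: e_ i))%:E))%E;
     last first.
  by apply: eq_integral => x _; rewrite dpsi mulrBr EFinB !EFinM.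
rewrite integralB// => /(congr1 oppe); rewrite oppeK => <-.
rewrite fin_num_oppeB ?integrable_fin_num// addeC.
by [].
Qed.

End weak_increment.

(** * Functions with equal integrals over boxes *)

Section cube_uniqueness.
Context {R : realType} {N : nat}.
Implicit Types (x a b c : 'rV[R]_N) (n : nat) (f : 'rV[R]_N -> \bar R).
Notation mu := (lebesgue_rV N).

Definition open_box a b : set 'rV[R]_N :=
  [set x | forall j, a ord0 j < x ord0 j < b ord0 j].

Definition orthant c : set 'rV[R]_N := [set x | forall j, x ord0 j < c ord0 j].

Lemma measurable_orthant c : measurable (orthant c).
Proof.
rewrite (_ : orthant c = \bigcap_(j in [set: 'I_N])
    (fun x : 'rV[R]_N => x ord0 j) @^-1` `]-oo, c ord0 j[); last first.
  apply/seteqP; split=> [x xc j _|x xc j] /=; first by rewrite in_itv/= xc.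
  by have := xc j Logic.I; rewrite /= in_itv.
apply: fin_bigcap_measurable => // j _.
by rewrite -[X in measurable X]setTI; exact: measurable_coord.
Qed.

Lemma measurable_open_box a b : measurable (open_box a b).
Proof.
rewrite (_ : open_box a b = \bigcap_(j in [set: 'I_N])
    (fun x : 'rV[R]_N => x ord0 j) @^-1` `]a ord0 j, b ord0 j[); last first.
  apply/seteqP; split=> [x xc j _|x xc j] /=; first by rewrite in_itv/= xc.
  by have := xc j Logic.I; rewrite /= in_itv.
apply: fin_bigcap_measurable => // j _.
by rewrite -[X in measurable X]setTI; exact: measurable_coord.
Qed.

Definition orthants : set (set 'rV[R]_N) := range orthant.

Lemma orthants_setI : setI_closed orthants.
Proof.
move=> _ _ [c _ <-] [d _ <-].
exists (\row_j Num.min (c ord0 j) (d ord0 j)) => //.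
apply/seteqP; split=> x; rewrite /orthant/=.
  by move=> xcd; split=> j; have := xcd j; rewrite mxE lt_min => /andP[].
by move=> [xc xd] j; rewrite mxE lt_min xc xd.
Qed.

Lemma measurable_orthantsE :
  @measurable _ 'rV[R]_N = <<s orthants >>.
Proof.
apply/seteqP; split; last first.
  apply: smallest_sub; first exact: sigma_algebra_measurable.
  by move=> _ [c _ <-]; exact: measurable_orthant.
have mid : measurable_fun setT
    (idfun : g_sigma_algebraType orthants -> 'rV[R]_N).
  apply: measurable_fun_rV => i.
  apply: (measurability _ (RGenInftyO.measurableE R)) => _ [_ [t ->] <-].
  rewrite setTI.
  rewrite (_ : _ @^-1` _ = \bigcup_n
    orthant (\row_j if j == i then t else n%:R)).
    apply: bigcup_measurable => n _; apply: sub_sigma_algebra.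
    by eexists.
  apply/seteqP; split=> x /=.
    rewrite in_itv/= => xt.
    have [n xn] : exists n : nat, forall j, x ord0 j < n%:R.
      exists (\sum_j Num.bound `|x ord0 j|)%N => j.
      rewrite (le_lt_trans (ler_norm _))// (lt_le_trans (archi_boundP _))//.
      by rewrite ler_nat (bigD1 j)//= leq_addr.
    by exists n => // j; rewrite mxE; case: eqP => [->|].
  by move=> [n _ /(_ i)]; rewrite mxE eqxx in_itv.
move=> A mA; have := mid measurableT A mA.
by rewrite setTI.
Qed.

(** The sets over which the two integrals agree form a Dynkin class. The
    orthants generate the measurable sets, are stable under intersection, and
    cut out of the box the boxes with the same lower corner. *)
Lemma ae_eq_of_boxes a b f1 f2 :
  mu.-integrable setT f1 -> mu.-integrable setT f2 ->
  (forall c, (forall j, c ord0 j <= b ord0 j) ->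
    (\int[mu]_(x in open_box a c) f1 x = \int[mu]_(x in open_box a c) f2 x)%E)
      ->
  ae_eq mu (open_box a b) f1 f2.
Proof.
move=> i1 i2 H; set D := open_box a b.
have mD : measurable D := measurable_open_box a b.
have iS f A : measurable A -> mu.-integrable setT f -> mu.-integrable A f.
  by move=> mA; exact: integrableS.
apply: integral_ae_eq => //; first exact: iS.
  by apply: measurable_funTS; exact: measurable_int i2.
suff HA A : measurable A ->
    (\int[mu]_(x in A `&` D) f1 x = \int[mu]_(x in A `&` D) f2 x)%E.
  by move=> A AD mA; have := HA A mA; rewrite setIidl.
rewrite {1}measurable_orthantsE; move: A; apply: (@dynkin_induction _ _ orthants
  (fun A => \int[mu]_(x in A `&` D) f1 x = \int[mu]_(x in A `&` D) f2 x)%E).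
- exact: measurable_orthantsE.
- exact: orthants_setI.
- by rewrite setTI; exact: H.
- move=> _ [c _ <-].
  rewrite (_ : _ `&` _ = open_box a (\row_j Num.min (c ord0 j) (b ord0 j))).
    by apply: H => j; rewrite mxE ge_min lexx orbT.
  apply/seteqP; split=> x; rewrite /orthant/D/open_box/=.
    by move=> [xc xab] j; have /andP[ax xb] := xab j;
      rewrite mxE ax lt_min xc xb.
  move=> xc; split=> j; have := xc j; rewrite mxE lt_min => /and3P[? ? ?] //.
  exact/andP.
- move=> A mA HA.
  have mAD : measurable (A `&` D) by exact: measurableI.
  have mCAD : measurable (~` A `&` D) by apply: measurableI => //;
    exact: measurableC.
  have DE : D = (A `&` D) `|` (~` A `&` D) by rewrite -setIUl setUv setTI.
  have disj : [disjoint A `&` D & ~` A `&` D].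
    by apply/disj_setPS => x [[Ax _] [nAx _]].
  have split_ f : mu.-integrable setT f ->
      (\int[mu]_(x in ~` A `&` D) f x = \int[mu]_(x in D) f x -
        \int[mu]_(x in A `&` D) f x)%E.
    move=> fi; rewrite [in X in (X - _)%E]DE integral_setU//; last first.
      by apply: measurable_funTS; exact: measurable_int fi.
    by rewrite addeAC subee ?add0e// integrable_fin_num//; exact: iS.
  by rewrite !split_// HA H.
- move=> F mF tF HF; rewrite setI_bigcupl !integral_bigcup//.
  + by apply: eq_eseriesr => k _; exact: HF.
  + exact: trivIset_setIr.
  + by move=> k; exact: measurableI.
  + by apply: iS => //; apply: bigcup_measurable => k _; exact: measurableI.
  + exact: trivIset_setIr.
  + by move=> k; exact: measurableI.
  + by apply: iS => //; apply: bigcup_measurable => k _; exact: measurableI.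
Qed.

Lemma integral_box_bump_cvg a b f : mu.-integrable setT f ->
  (\int[mu]_x (f x * (box_bump a b n x)%:E) @[n --> \oo] -->
   \int[mu]_(x in open_box a b) f x)%E.
Proof.
move=> fi; have mf := measurable_int _ fi.
have mb n := measurable_box_bump a b n.
have mB : measurable (open_box a b) := measurable_open_box a b.
have -> : (\int[mu]_(x in open_box a b) f x =
    \int[mu]_x (f x * (\1_(open_box a b) x)%:E))%E.
  rewrite integral_mkcond; apply: eq_integral => x _.
  by rewrite patchE indicE; case: ifPn => _; rewrite ?mule1 ?mule0.
have [] := @dominated_convergence _ _ _ mu setT measurableT
  (fun n x => (f x * (box_bump a b n x)%:E)%E)
  (fun x => (f x * (\1_(open_box a b) x)%:E)%E) (fun x => `|f x|%E).
- by move=> n; apply: emeasurable_funM => //; exact/measurable_EFinP.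
- by apply: emeasurable_funM => //; exact/measurable_EFinP.
- apply: filterS (integrable_ae measurableT fi) => x fx _.
  apply: cvgeZl; first exact: fx.
  by apply/fine_cvgP; split; [exact: nearW|exact: box_bump_cvg].
- exact: integrable_abse.
- apply: aeW => x n _; rewrite abseM -[leRHS]mule1 lee_pmul// lee_fin.
  exact: box_bump_le1.
- by [].
Qed.

End cube_uniqueness.

(** * Inequalities for powers *)

Section power_inequalities.
Context {R : realType}.
Implicit Types (p : R) (d h l t : R).
Notation la := (@lebesgue_measure R).

Lemma powR_inv t r : 0 <= t -> t^-1 `^ r = (t `^ r)^-1.
Proof. by move=> t0; rewrite -powR_inv1// -powRrM mulN1r powRN. Qed.

Lemma powR_exprn t r n : 0 <= t -> (t ^+ n) `^ r = (t `^ r) ^+ n.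
Proof.
move=> t0; rewrite -(powR_mulrn n t0) -(powR_mulrn n (powR_ge0 t r)).
by rewrite -!powRrM mulrC.
Qed.

Lemma powR_split p t : 1 < p -> 0 <= t -> t `^ p = t * t `^ (p - 1).
Proof.
move=> p1 t0; rewrite -{2}(powRr1 t0) -powRD;
  first by rewrite addrCA subrr addr0.
by rewrite addrCA subrr addr0 gt_eqF// (lt_trans ltr01).
Qed.

(** Where t exceeds l, the factor (t / l)^(p - 1) is at least 1. *)
Lemma young_threshold p l t : 1 < p -> 0 < l -> 0 <= t ->
  t <= l + l `^ (1 - p) * t `^ p.
Proof.
move=> p1 l0 t0; have [tl|lt] := leP t l.
  by rewrite (le_trans tl)// lerDl mulr_ge0// powR_ge0.
apply: (@le_trans _ _ (l `^ (1 - p) * t `^ p)); last by rewrite lerDr ltW.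
rewrite -opprB powRN ler_pdivlMl ?powR_gt0//
  (powR_split p1 t0) mulrC ler_wpM2l//.
by apply: ge0_ler_powR; rewrite ?nnegrE ?subr_ge0// ltW.
Qed.

(** Jensen's inequality up to the factor 2^p: the part of f below the threshold
    d / (2 h) contributes at most half of d, and above it [young_threshold]
    trades f for f^p. *)
Lemma powR_integral_segment p h d (f : R -> R) : 1 < p -> 0 < h -> 0 <= d ->
  measurable_fun setT f -> (forall t, 0 <= f t) ->
  (d%:E <= \int[la]_(t in `[0%R, h]) (f t)%:E)%E ->
  ((d `^ p)%:E <= (2 `^ p * h `^ (p - 1))%:E *
     \int[la]_(t in `[0%R, h]) (f t `^ p)%:E)%E.
Proof.
move=> p1 h0 d0 mf f0 dI.
have p0 : 0 < p := lt_trans ltr01 p1.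
have I0 : (0 <= \int[la]_(t in `[0%R, h]) (f t `^ p)%:E)%E.
  by apply: integral_ge0 => t _; rewrite lee_fin powR_ge0.
have [->|dn0] := eqVneq d 0.
  rewrite powR0 ?gt_eqF// mule_ge0// lee_fin mulr_ge0// ?powR_ge0//.
have {dn0} d0' : 0 < d by rewrite lt_neqAle eq_sym dn0.
have lh : la `[0%R, h] = h%:E.
  by rewrite lebesgue_measure_itv/= lte_fin h0 oppr0 adde0.
(* below this threshold f integrates to at most d / 2 *)
pose l := d / (2 * h).
have l0 : 0 < l by rewrite divr_gt0// mulr_gt0.
have dl : d = l * (2 * h) by rewrite /l divfK// mulf_neq0// gt_eqF.
clearbody l.
have mfp : measurable_fun setT (fun t => f t `^ p).
  exact: (measurableT_comp (measurable_powR p) mf).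
have key : ((d / 2)%:E <= (l `^ (1 - p))%:E *
    \int[la]_(t in `[0%R, h]) (f t `^ p)%:E)%E.
  have : (d%:E <= (d / 2)%:E + (l `^ (1 - p))%:E *
      \int[la]_(t in `[0%R, h]) (f t `^ p)%:E)%E.
    apply: (le_trans dI).
    apply: (@le_trans _ _ (\int[la]_(t in `[0%R, h])
        (l%:E + (l `^ (1 - p))%:E * (f t `^ p)%:E))%E).
      apply: ge0_le_integral => //.
      - by move=> t _; rewrite lee_fin.
      - exact/measurable_EFinP/measurable_funTS.
      - apply: emeasurable_funD => //; apply: measurable_funeM.
        exact/measurable_EFinP/measurable_funTS.
      - by move=> t _; rewrite -EFinM -EFinD lee_fin; exact: young_threshold.
    rewrite ge0_integralD//=; last 3 first.
    - by move=> t _; rewrite lee_fin ltW.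
    - by move=> t _; rewrite -EFinM lee_fin mulr_ge0// powR_ge0.
    - apply: measurable_funeM; exact/measurable_EFinP/measurable_funTS.
    rewrite integral_cst//= [X in (_ * X)%E]lh ge0_integralZl//; last 3 first.
    - exact/measurable_EFinP/measurable_funTS.
    - by move=> t _; rewrite lee_fin powR_ge0.
    - by rewrite lee_fin powR_ge0.
    by rewrite -EFinM (_ : l * h = d / 2)// dl; field.
  have dd : d - d / 2 = d / 2 by field.
  by rewrite -leeBlDl// -EFinB dd.
have := lee_wpmul2l _ key.
move=> /(_ (2 * d `^ (p - 1))%:E); rewrite lee_fin mulr_ge0 ?powR_ge0//
  => /(_ isT).
rewrite -EFinM muleA -EFinM.
rewrite (_ : 2 * d `^ (p - 1) * (d / 2) = d `^ p); last first.
  by rewrite [RHS]powR_split// ?ltW//; field.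
rewrite (_ : 2 * d `^ (p - 1) * l `^ (1 - p) = 2 `^ p * h `^ (p - 1))//.
have -> : l `^ (1 - p) = (l `^ (p - 1))^-1 by rewrite -powRN opprB.
rewrite dl !powRM ?mulr_ge0 ?ltW//.
have -> : 2 `^ p = 2 * 2 `^ (p - 1) :> R by apply: powR_split.
have : l `^ (p - 1) != 0 by rewrite gt_eqF// powR_gt0.
set L := l `^ _ => L0. by field.
Qed.

(** Each term is at most the l^p norm of the family. *)
Lemma powR_sum_le n p (d : 'I_n -> R) : 1 < p ->
  `|\sum_i d i| `^ p <= n%:R `^ p * \sum_i `|d i| `^ p.
Proof.
move=> p1; have p0 : 0 < p := lt_trans ltr01 p1.
set S := \sum_i `|d i| `^ p.
have S0 : 0 <= S by apply: sumr_ge0 => i _; exact: powR_ge0.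
have dS i : `|d i| <= S `^ p^-1.
  have dSp : `|d i| `^ p <= S.
    by rewrite /S (bigD1 i)//= lerDl sumr_ge0// => j _; exact: powR_ge0.
  have -> : `|d i| = (`|d i| `^ p) `^ p^-1.
    by rewrite -powRrM mulfV ?gt_eqF// powRr1.
  by apply: ge0_ler_powR => //; rewrite ?nnegrE ?invr_ge0 ?powR_ge0// ltW.
have sum_le : `|\sum_i d i| <= n%:R * S `^ p^-1.
  apply: (le_trans (ler_norm_sum _ _ _)).
  apply: (le_trans (ler_sum _ (fun i _ => dS i))).
  by rewrite sumr_const card_ord mulr_natl.
apply: (@le_trans _ _ ((n%:R * S `^ p^-1) `^ p)).
  by apply: ge0_ler_powR => //; rewrite ?nnegrE ?mulr_ge0 ?powR_ge0// ltW.
by rewrite powRM ?powR_ge0// -powRrM mulVf ?gt_eqF// powRr1.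
Qed.

End power_inequalities.

(** * The increments of a function in L^p *)

Section shift_estimate.
Context {R : realType} {N : nat}.
Implicit Types (x y a b v : 'rV[R]_N) (w W G : 'rV[R]_N -> R)
  (g : 'rV[R]_N -> 'rV[R]_N) (E Om : set 'rV[R]_N) (i j : 'I_N) (n : nat).
Notation mu := (lebesgue_rV N).
Notation la := (@lebesgue_measure R).
Notation e_ i := (delta_mx ord0 i : 'rV[R]_N).

(** The fundamental theorem of calculus on almost every segment: the bumps
    tend to the indicators of boxes, so both sides have the same integral over
    every box. *)
Lemma weak_increment_ae E Om w g i (h : R) a b :
  is_weak_gradient E w g -> Om `<=` E ->
  let W := w \_ Om in let G := (fun x => g x ord0 i) \_ Om in
  mu.-integrable setT (EFin \o W) -> mu.-integrable setT (EFin \o G) ->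
  0 < h -> closed_box a b `<=` Om -> closed_box a (b + h *: e_ i) `<=` Om ->
  ae_eq mu (open_box a b) (fun x => (W (x + h *: e_ i) - W x)%:E)
    (fun x => \int[la]_t along G (e_ i) h (x, t))%E.
Proof.
move=> wg OmE W G iW iG h0 abOm abhOm.
have iWh := integrable_translate (h *: e_ i) iW.
have i1 : mu.-integrable setT (fun x => (W (x + h *: e_ i) - W x)%:E).
  by under eq_fun do rewrite EFinB; exact: integrableB.
have i2 := integrable_fubini_F (integrable_along (e_ i) (ltW h0) iG).
apply: ae_eq_of_boxes => // c cb.
have box_le b1 : closed_box a (c + b1) `<=` closed_box a (b + b1).
  move=> x xac j; have := xac j; rewrite !mxE => /andP[-> /= xc].
  by rewrite (le_trans xc)// lerD2r.
have acOm : closed_box a c `<=` Om.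
  by rewrite -(addr0 c); apply: subset_trans abOm;
    rewrite -[X in _ `<=` closed_box a X]addr0.
have achOm : closed_box a (c + h *: e_ i) `<=` Om by exact: subset_trans
  (box_le _) abhOm.
have eqn n := weak_increment_bump n wg OmE iW iG h0 acOm achOm.
have c1 := integral_box_bump_cvg (a := a) (b := c) i1.
have c2 := integral_box_bump_cvg (a := a) (b := c) i2.
rewrite -(cvg_lim _ c1)// -(cvg_lim _ c2)//; congr (lim (_ @ \oo)).
by apply/funext => n; exact: eqn.
Qed.

(** The p-th power of a segment integral of G is at most a multiple of
    h^(p - 1) times the segment integral of |G|^p; integrating the latter over
    x yields one more factor h, by translation invariance. *)
Lemma shift_estimate E Om w g i (h p : R) a b : 1 < p ->
  is_weak_gradient E w g -> Om `<=` E ->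
  let W := w \_ Om in let G := (fun x => g x ord0 i) \_ Om in
  mu.-integrable setT (EFin \o W) -> mu.-integrable setT (EFin \o G) ->
  0 < h -> closed_box a b `<=` Om -> closed_box a (b + h *: e_ i) `<=` Om ->
  (\int[mu]_(x in open_box a b) (`|W (x + h *: e_ i)%R - W x| `^ p)%:E <=
   (2 `^ p * h `^ p)%:E * \int[mu]_x (`|G x| `^ p)%:E)%E.
Proof.
move=> p1 wg OmE W G iW iG h0 abOm abhOm.
have p0 : 0 < p := lt_trans ltr01 p1.
have mB : measurable (open_box a b) := measurable_open_box a b.
have mW : measurable_fun setT W by have /measurable_EFinP :=
  measurable_int _ iW.
have mG : measurable_fun setT G by have /measurable_EFinP :=
  measurable_int _ iG.
have mWh : measurable_fun setT (fun x => W (x + h *: e_ i)).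
  exact: (measurableT_comp mW (measurable_translate (h *: e_ i))).
pose Gp x := `|G x| `^ p.
have mGp : measurable_fun setT Gp.
  by apply: (measurableT_comp (measurable_powR p)); exact: measurableT_comp.
have along0 x t : (0 <= along Gp (e_ i) h (x, t))%E.
  by rewrite lee_fin mulr_ge0// powR_ge0.
have mal : measurable_fun setT (fun x => \int[la]_t along Gp (e_ i) h (x, t))%E.
  by apply: (measurable_fun_fubini_tonelli_F (along Gp (e_ i) h)) => //;
    [exact: measurable_along|case].
have c0 : 0 <= 2 `^ p * h `^ (p - 1) by rewrite mulr_ge0 ?powR_ge0.
apply: (@le_trans _ _ (\int[mu]_(x in open_box a b)
   ((2 `^ p * h `^ (p - 1))%:E * \int[la]_t along Gp (e_ i) h (x, t)))%E).
  apply: ae_ge0_le_integral => //.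
  - apply/measurable_EFinP/measurable_funTS.
    apply: (measurableT_comp (measurable_powR p)).
    by apply: measurableT_comp => //; exact: measurable_funB.
  - by move=> x _; rewrite mule_ge0//; exact: integral_ge0.
  - by apply: measurable_funeM; exact: measurable_funTS.
  - apply: filterS (weak_increment_ae wg OmE iW iG h0 abOm abhOm) => x /[apply]
      xE.
    have mGx : measurable_fun setT (fun t : measurableTypeR R => G
      (x + t *: e_ i)).
      by apply: (measurableT_comp mG); exact:
        (measurableT_comp (measurable_line (e_ i)) (measurable_pair1 x)).
    have restr (F : 'rV[R]_N -> R) : (\int[la]_t along F (e_ i) h (x, t) =
        \int[la]_(t in `[0%R, h]) (F (x + t *: e_ i)%R)%:E)%E.
      rewrite [RHS]integral_mkcond; apply: eq_integral => t _.
      by rewrite patchE /along/= indicE; case: ifPn => _; rewrite ?mulr1 ?mulr0.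
    rewrite restr; apply: powR_integral_segment => //.
      exact: measurableT_comp.
    rewrite -[leLHS]/(`| (W (x + h *: e_ i)%R - W x)%:E |)%E xE restr.
    by apply: le_abse_integral => //; exact/measurable_EFinP/measurable_funTS.
apply: (@le_trans _ _ (\int[mu]_x
   ((2 `^ p * h `^ (p - 1))%:E * \int[la]_t along Gp (e_ i) h (x, t)))%E).
  apply: ge0_subset_integral => //.
  - exact: measurable_funeM.
  - by move=> x _; rewrite mule_ge0//; exact: integral_ge0.
rewrite ge0_integralZl//; last by move=> x _; exact: integral_ge0.
rewrite (fubini_tonelli (along Gp (e_ i) h)); last 2 first.
- exact: measurable_along.
- by case.
have := integral_along_abs (e_ i) (ltW h0) mGp.
under eq_integral do under eq_integral do rewrite gee0_abs//.
move=> ->; rewrite muleA -EFinM -mulrA [_ * h]mulrC -(powR_split p1 (ltW h0)).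
rewrite (eq_integral (fun x => (`|G x| `^ p)%:E))// => x _.
by rewrite gee0_abs// lee_fin powR_ge0.
Qed.

(** The corners of a path along the axes from 0 to v. *)
Definition prefix_row v (k : nat) : 'rV[R]_N :=
  \row_j (if (j < k)%N then v ord0 j else 0).

Lemma prefix_rowS v i :
  prefix_row v i.+1 = prefix_row v i + v ord0 i *: e_ i.
Proof.
apply/rowP => j; rewrite !mxE eqxx/= ltnS leq_eqVlt -val_eqE/=.
by case: ltngtP => [||/val_inj ->]; rewrite ?mulr0 ?addr0 ?mulr1 ?add0r.
Qed.

Lemma prefix_row_full v : prefix_row v N = v.
Proof. by apply/rowP => j; rewrite mxE ltn_ord. Qed.

Lemma cube_box y (r : R) : cube y r = open_box (y - const_mx r)
  (y + const_mx r).
Proof.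
apply/seteqP; split=> x xc j; have := xc j; rewrite /= ?mxE.
  by rewrite ltr_distl.
by rewrite ltr_distl.
Qed.

(** The translation by v is split into N steps along the axes. Each step starts
    from the cube shifted by the previous ones; since the coordinates of v are
    positive and below eps, all these cubes stay inside Om. *)
Lemma cube_shift_estimate E w g y (p rho eps : R) v : 1 < p ->
  is_weak_gradient E w g ->
  cube y (rho + eps) `<=` E ->
  let Om := cube y (rho + eps) in
  let W := w \_ Om in let G i := (fun x => g x ord0 i) \_ Om in
  mu.-integrable setT (EFin \o W) ->
  (forall i, mu.-integrable setT (EFin \o G i)) ->
  (forall i, 0 < v ord0 i < eps) ->
  (\int[mu]_(x in cube y rho) (`|W (x + v)%R - W x| `^ p)%:E <=
   (N%:R `^ p * (2 `^ p * eps `^ p))%:E * \sum_i \int[mu]_x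
     (`|G i x| `^ p)%:E)%E.
Proof.
move=> p1 wg OmE Om W G iW iG v0.
have p0 : 0 < p := lt_trans ltr01 p1.
have mW : measurable_fun setT W by have /measurable_EFinP :=
  measurable_int _ iW.
have mWt u : measurable_fun setT (fun x => W (x + u)).
  exact: (measurableT_comp mW (measurable_translate u)).
pose d (i : 'I_N) x := W (x + prefix_row v i.+1) - W (x + prefix_row v i).
have md i : measurable_fun setT (fun x => `|d i x| `^ p).
  apply: (measurableT_comp (measurable_powR p)).
  by apply: measurableT_comp => //; exact: measurable_funB.
have mcube : measurable (cube y rho) := measurable_cube y rho.
have step i : (\int[mu]_(x in cube y rho) (`|d i x| `^ p)%:E <=
    (2 `^ p * eps `^ p)%:E * \int[mu]_x (`|G i x| `^ p)%:E)%E.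
  have /andP[vi0 vie] := v0 i.
  pose z := y + prefix_row v i.
  have -> : (\int[mu]_(x in cube y rho) (`|d i x| `^ p)%:E =
     \int[mu]_(x in cube z rho) (`|W (x + v ord0 i *: e_ i)%R - W x| `^
       p)%:E)%E.
    rewrite -[RHS](ge0_integral_translate (prefix_row v i)).
    - rewrite (_ : _ @^-1` _ = cube y rho); last first.
        by apply/seteqP; split=> x xc j; have := xc j;
          rewrite /translate /z !mxE opprD addrACA subrr addr0.
      by apply: eq_integral => x _; rewrite /d prefix_rowS addrA.
    - exact: measurable_cube.
    - apply/measurable_EFinP/measurable_funTS.
      apply: (measurableT_comp (measurable_powR p)).
      by apply: measurableT_comp => //; exact: measurable_funB.
    - by move=> x; rewrite lee_fin powR_ge0.
  have zin x : closed_box (z - const_mx rho)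
    (z + const_mx rho + v ord0 i *: e_ i) x -> Om x.
    move=> xz j; have := xz j; rewrite /z !mxE eqxx/= => /andP[z1 z2].
    have /andP[vj0 vje] := v0 j.
    rewrite ltr_distl; case: (ltngtP j i) z1 z2 => [ji|ji|/val_inj ji];
      last 1 first.
    - by subst j; rewrite eqxx mulr1 => z1 z2; apply/andP; split; lra.
    - by rewrite -val_eqE/= ltn_eqF// mulr0 => z1 z2; apply/andP; split; lra.
    - by rewrite -val_eqE/= gtn_eqF// mulr0 => z1 z2; apply/andP; split; lra.
  have zin0 : closed_box (z - const_mx rho) (z + const_mx rho) `<=` Om.
    move=> x xz; apply: zin => j; have /andP[-> /= z2] := xz j.
    by rewrite [leRHS]mxE (le_trans z2)// lerDl !mxE eqxx mulr_ge0// ltW.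
  rewrite cube_box; apply: le_trans.
    exact: (shift_estimate p1 wg OmE iW (iG i) vi0 zin0 zin).
  apply: lee_wpmul2r; first by apply: integral_ge0 => x _;
    rewrite lee_fin powR_ge0.
  rewrite lee_fin ler_wpM2l ?powR_ge0//.
  by apply: ge0_ler_powR; rewrite ?nnegrE ?ltW// (lt_trans vi0).
apply: (@le_trans _ _ (\int[mu]_(x in cube y rho)
    ((N%:R `^ p)%:E * \sum_(i < N) (`|d i x| `^ p)%:E))%E).
  apply: ge0_le_integral => //.
  - apply/measurable_EFinP/measurable_funTS.
    apply: (measurableT_comp (measurable_powR p)).
    by apply: measurableT_comp => //; exact: measurable_funB.
  - apply: measurable_funeM; apply: emeasurable_fun_sum => i.
    exact/measurable_EFinP/measurable_funTS.
  - move=> x _; rewrite sumEFin -EFinM lee_fin.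
    apply: le_trans (powR_sum_le _ p1).
    rewrite /d -(big_mkord xpredT (fun k =>
      W (x + prefix_row v k.+1) - W (x + prefix_row v k))).
    rewrite telescope_sumr// prefix_row_full.
    by rewrite (_ : prefix_row v 0 = 0) ?addr0//; apply/rowP => j; rewrite !mxE.
rewrite ge0_integralZl ?lee_fin ?powR_ge0//; last 2 first.
- apply: emeasurable_fun_sum => i; exact/measurable_EFinP/measurable_funTS.
- by move=> x _; apply: sume_ge0 => i _; rewrite lee_fin powR_ge0.
rewrite ge0_integral_sum//; last by move=> i;
  exact/measurable_EFinP/measurable_funTS.
rewrite EFinM -muleA lee_wpmul2l ?lee_fin ?powR_ge0//.
rewrite ge0_sume_distrr; last by move=> i _; apply: integral_ge0 => x _;
  rewrite lee_fin powR_ge0.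
exact: lee_sum.
Qed.

End shift_estimate.

(** * A Faber-Krahn inequality *)

Section faber_krahn.
Context {R : realType} {N : nat}.
Implicit Types (x y v : 'rV[R]_N) (w : 'rV[R]_N -> R)
  (g : 'rV[R]_N -> 'rV[R]_N) (E Om K : set 'rV[R]_N) (i j : 'I_N).
Notation mu := (lebesgue_rV N).

Lemma tonelli_sets d1 d2 (T1 : measurableType d1) (T2 : measurableType d2)
    (m1 : {sigma_finite_measure set T1 -> \bar R})
    (m2 : {sigma_finite_measure set T2 -> \bar R})
    (A : set T1) (B : set T2) (f : T1 * T2 -> \bar R) :
  measurable A -> measurable B -> measurable_fun setT f ->
  (forall z, 0 <= f z)%E ->
  (\int[m1]_(x in A) \int[m2]_(z in B) f (x, z) =
   \int[m2]_(z in B) \int[m1]_(x in A) f (x, z))%E.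
Proof.
move=> mA mB mf f0.
pose F z := (f z * (\1_A z.1 * \1_B z.2)%:E)%E.
have mF : measurable_fun setT F.
  apply: emeasurable_funM => //; apply/measurable_EFinP; apply: measurable_funM.
    exact: (measurableT_comp (measurable_indic mA) measurable_fst).
  exact: (measurableT_comp (measurable_indic mB) measurable_snd).
have F0 z : (0 <= F z)%E by rewrite mule_ge0// lee_fin mulr_ge0.
transitivity (\int[m1]_x \int[m2]_z F (x, z))%E.
  rewrite integral_mkcond; apply: eq_integral => x _.
  rewrite patchE; case: ifPn => xA; last first.
    by rewrite integral0_eq// => z _; rewrite /F/= !indicE
      (negbTE xA) mul0r mule0.
  rewrite integral_mkcond; apply: eq_integral => z _.
  by rewrite patchE /F/= !indicE xA mul1r; case: ifPn; rewrite ?mule1 ?mule0.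
rewrite (fubini_tonelli F)//; apply/esym.
rewrite integral_mkcond; apply: eq_integral => z _.
rewrite patchE; case: ifPn => zB; last first.
  by rewrite integral0_eq// => x _; rewrite /F/= !indicE
    (negbTE zB) mulr0 mule0.
rewrite integral_mkcond; apply: eq_integral => x _.
by rewrite patchE /F/= !indicE zB mulr1; case: ifPn; rewrite ?mule1 ?mule0.
Qed.

Lemma measurable_section_integral d1 d2 (T1 : measurableType d1)
    (T2 : measurableType d2) (m2 : {sigma_finite_measure set T2 -> \bar R})
    (B : set T2) (f : T1 * T2 -> \bar R) :
  measurable B -> measurable_fun setT f -> (forall z, 0 <= f z)%E ->
  measurable_fun setT (fun s : T1 => \int[m2]_(z in B) f (s, z))%E.
Proof.
move=> mB mf f0; pose F z := (f z * (\1_B z.2)%:E)%E.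
have mF : measurable_fun setT F.
  apply: emeasurable_funM => //; apply/measurable_EFinP.
  exact: (measurableT_comp (measurable_indic mB) measurable_snd).
have F0 z : (0 <= F z)%E by rewrite mule_ge0// lee_fin.
rewrite (_ : (fun s => _) = (fun s : T1 => \int[m2]_z F (s, z))%E).
  exact: (measurable_fun_fubini_tonelli_F F).
apply/funext => x; rewrite integral_mkcond; apply: eq_integral => z _.
by rewrite patchE /F/= indicE; case: ifPn; rewrite ?mule1 ?mule0.
Qed.

Lemma measurable_closed_box (a b : 'rV[R]_N) : measurable (closed_box a b).
Proof.
rewrite (_ : closed_box a b = \bigcap_(j in [set: 'I_N])
    (fun x : 'rV[R]_N => x ord0 j) @^-1` `[a ord0 j, b ord0 j]); last first.
  apply/seteqP; split=> [x xc j _|x xc j] /=; first by rewrite in_itv/= xc.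
  by have := xc j Logic.I; rewrite /= in_itv.
apply: fin_bigcap_measurable => // j _.
by rewrite -[X in measurable X]setTI; exact: measurable_coord.
Qed.

Lemma Lp_loc_integrable E K Om w : measurable E -> Lp_loc 1 E w ->
  compact K -> measurable K -> K `<=` E -> measurable Om -> Om `<=` K ->
  mu.-integrable setT (EFin \o (w \_ Om)).
Proof.
move=> mE [mw wK] cK mK KE mOm OmK.
rewrite -restrict_EFin; apply/integrable_restrict => //; rewrite setTI.
apply: (integrableS mK) => //.
apply/integrableP; split.
  by apply/measurable_EFinP; apply: measurable_funS mw.
have := wK K cK KE; congr (_ < _)%E; apply: eq_integral => x _.
by rewrite /= powRr1.
Qed.

Lemma enorm_ge (v : 'rV[R]_N) i : `|v ord0 i| <= enorm v.
Proof.
rewrite -sqrtr_sqr ler_wsqrtr// (bigD1 i)//= lerDl sumr_ge0// => j _.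
exact: sqr_ge0.
Qed.

Lemma measurable_enorm E g :
  (forall i, measurable_fun E (fun x => g x ord0 i)) ->
  measurable_fun E (fun x => enorm (g x)).
Proof.
move=> mg; apply: (@measurableT_comp _ _ _ _ _ _ (@Num.sqrt R)).
  by apply: continuous_measurable_fun; exact: sqrt_continuous.
by apply: measurable_sum => i; exact: measurable_funX.
Qed.

(** For at least half of the steps h in (0, eps)^N the function vanishes at
    x + h, so |w x| is an increment of w; averaging over h turns the bound on
    increments into a bound on w itself. *)
Lemma faber_krahn E w g y (p rho eps : R) : 1 < p -> 0 < eps ->
  open E -> is_weak_gradient E w g ->
  closed_box (y - const_mx (rho + eps)) (y + const_mx (rho + eps)) `<=` E ->
  (mu (cube y (rho + eps) `&` [set x | w x != 0%R]) <= (eps ^+ N / 2)%:E)%E ->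
  (\int[mu]_(x in cube y rho) (`|w x| `^ p)%:E <=
   (2 * N%:R * N%:R `^ p * 2 `^ p * eps `^ p)%:E *
     \int[mu]_(x in cube y (rho + eps)) (enorm (g x) `^ p)%:E)%E.
Proof.
move=> p1 eps0 oE wg KE small.
have p0 : 0 < p := lt_trans ltr01 p1.
have mE : measurable E := open_measurable_rV oE.
set Om := cube y (rho + eps); set K := closed_box _ _ in KE.
have mOm : measurable Om := measurable_cube y (rho + eps).
have OmK : Om `<=` K.
  rewrite /Om cube_box => x xO j; have /andP[? ?] := xO j.
  by rewrite !ltW.
have OmE : Om `<=` E := subset_trans OmK KE.
have cK : compact K by exact: compact_closed_box.
have [wL gL _] := wg.
pose W := w \_ Om; pose G i := (fun x => g x ord0 i) \_ Om.
have mK : measurable K := measurable_closed_box _ _.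
have iW : mu.-integrable setT (EFin \o W) :=
  Lp_loc_integrable mE wL cK mK KE mOm OmK.
have iG i : mu.-integrable setT (EFin \o G i) :=
  Lp_loc_integrable mE (gL i) cK mK KE mOm OmK.
have mW : measurable_fun setT W by have /measurable_EFinP :=
  measurable_int _ iW.
have GI i : (\int[mu]_x (`|G i x| `^ p)%:E <=
    \int[mu]_(x in Om) (enorm (g x) `^ p)%:E)%E.
  rewrite (_ : (\int[mu]_x _ = \int[mu]_(x in Om) (`|g x ord0 i| `^ p)%:E)%E);
    last first.
    rewrite [RHS]integral_mkcond; apply: eq_integral => x _.
    by rewrite /G !patchE; case: ifPn => // _; rewrite normr0 powR0 ?gt_eqF.
  apply: ge0_le_integral => //.
  - apply/measurable_EFinP; apply: (measurableT_comp (measurable_powR p)).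
    apply: measurableT_comp => //; apply: measurable_funS (gL i).1 => //.
  - apply/measurable_EFinP; apply: (measurableT_comp (measurable_powR p)).
    by apply: measurable_enorm => j; apply: measurable_funS (gL j).1.
  - move=> x _; rewrite lee_fin; apply: ge0_ler_powR;
      by rewrite ?nnegrE ?sqrtr_ge0 ?enorm_ge// ltW.
set I := (\int[mu]_(x in Om) (enorm (g x) `^ p)%:E)%E in GI *.
have I0 : (0 <= I)%E by apply: integral_ge0 => x _; rewrite lee_fin powR_ge0.
pose c := N%:R `^ p * (2 `^ p * eps `^ p).
have c0 : 0 <= c by rewrite !mulr_ge0 ?powR_ge0.
pose Q : set 'rV[R]_N := cube (const_mx (eps / 2)) (eps / 2).
have mQ : measurable Q := measurable_cube _ _.
have Qv v : Q v -> forall j, 0 < v ord0 j < eps.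
  by move=> Qv j; have := Qv j; rewrite mxE ltr_distl => /andP[? ?];
    apply/andP; split; lra.
have muQ : mu Q = (eps ^+ N)%:E.
  by rewrite lebesgue_rV_cube ?divr_gt0// (_ : (eps / 2) *+ 2 = eps)//
    mulr2n -splitr.
have epsN : 0 < eps ^+ N by rewrite exprn_gt0.
pose k (z : 'rV[R]_N * 'rV[R]_N) := (`|W (z.1 + z.2) - W z.1| `^ p)%:E.
have mk : measurable_fun setT k.
  apply/measurable_EFinP; apply: (measurableT_comp (measurable_powR p)).
  apply: measurableT_comp => //; apply: measurable_funB.
    apply: (measurableT_comp mW); apply: measurable_fun_rV => j.
    under eq_fun do rewrite mxE; apply: measurable_funD.
      exact: (measurableT_comp (measurable_coord j) measurable_fst).
    exact: (measurableT_comp (measurable_coord j) measurable_snd).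
  exact: (measurableT_comp mW measurable_fst).
have k0 z : (0 <= k z)%E by rewrite lee_fin powR_ge0.
have mcube : measurable (cube y rho) := measurable_cube y rho.
have lower x : cube y rho x ->
    ((eps ^+ N / 2)%:E * (`|w x| `^ p)%:E <= \int[mu]_(v in Q) k (x, v))%E.
  move=> xc; pose Z := Q `&` [set v | W (x + v) = 0].
  have mWx : measurable_fun setT (fun v => W (x + v)).
    rewrite (_ : (fun v => _) = W \o translate x); last first.
      by apply/funext => v; rewrite /= /translate addrC.
    exact: (measurableT_comp mW (measurable_translate x)).
  have mZ : measurable Z.
    apply: measurableI => //; rewrite -[X in measurable X]setTI.
    exact: (mWx measurableT [set 0]).
  have xOm : Om x.
    by move=> j; apply: (lt_trans (xc j)); rewrite ltrDl.
  have Wx : W x = w x by rewrite /W patchE mem_set.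
  (* the other steps lie in a translate of the support of w in Om *)
  have muZ : ((eps ^+ N / 2)%:E <= mu Z)%E.
    have mA : measurable (Om `&` [set z | w z != 0%R]).
      rewrite (_ : _ `&` _ = ~` (W @^-1` [set 0])).
        apply: measurableC; rewrite -[X in measurable X]setTI.
        exact: (mW measurableT [set 0]).
      apply/seteqP; split=> z /=; rewrite /W patchE.
        by move=> [zO /eqP wz]; rewrite mem_set.
      by case: ifPn => [/set_mem zO /eqP|].
    have mtA : measurable (translate x @^-1` (Om `&` [set z | w z != 0%R])).
      by rewrite -[X in measurable X]setTI; exact: measurable_translate.
    have : (mu Q <= mu Z + mu (translate x @^-1`
      (Om `&` [set z | w z != 0%R])))%E.
      apply: (le_trans _ (measureU2 _ mZ mtA)); apply: le_measure;
        rewrite ?inE//.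
        exact: measurableU.
      move=> v Qv'; have [Wv|/eqP Wv] := eqVneq (W (x + v)) 0; first by left.
      right; rewrite /translate /=; move: Wv; rewrite addrC /W patchE.
      by case: ifPn => // /set_mem zO /eqP.
    rewrite lebesgue_rV_translate// => QZ.
    have := le_trans QZ (leeD2l _ small); rewrite muQ.
    rewrite -leeBlDr// -EFinB; congr (_ <= _)%E; congr (_%:E).
    by rewrite {1}(splitr (eps ^+ N)) addrK.
  apply: (@le_trans _ _ (\int[mu]_(v in Z) k (x, v))%E); last first.
    apply: ge0_subset_integral => //; last exact: subIsetl.
    exact/measurable_funTS/(measurableT_comp mk)/measurable_pair1.
  rewrite (eq_integral (fun=> (`|w x| `^ p)%:E)); last first.
    by move=> v /set_mem[_ /= Wv]; rewrite /k/= Wv sub0r normrN Wx.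
  by rewrite integral_cst// muleC lee_wpmul2l// lee_fin powR_ge0.
have mw : measurable_fun (cube y rho) w.
  apply: measurable_funS wL.1 => // x xc; apply: OmE => j.
  by apply: (lt_trans (xc j)); rewrite ltrDl.
have : ((eps ^+ N / 2)%:E * \int[mu]_(x in cube y rho) (`|w x| `^ p)%:E <=
    (eps ^+ N)%:E * (c%:E * (N%:R%:E * I)))%E.
  rewrite -ge0_integralZl//; last 2 first.
  - apply/measurable_EFinP; apply: (measurableT_comp (measurable_powR p)).
    exact: measurableT_comp.
  - by rewrite lee_fin divr_ge0// ltW.
  apply: (@le_trans _ _ (\int[mu]_(x in cube y rho) \int[mu]_(v in Q) k
    (x, v))%E).
    apply: ge0_le_integral => //.
    - by move=> x _; rewrite -EFinM lee_fin mulr_ge0 ?powR_ge0// divr_ge0// ltW.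
    - apply: measurable_funeM; apply/measurable_EFinP.
      by apply: (measurableT_comp (measurable_powR p)); exact: measurableT_comp.
    - by apply: measurable_funTS; exact: measurable_section_integral.
  rewrite tonelli_sets// -muQ muleC -integral_cst//.
  apply: ge0_le_integral; first exact: mQ.
  - by move=> v _; exact: integral_ge0.
  - apply: measurable_funTS.
    apply: (@measurable_section_integral _ _ _ _ mu _ (fun z => k (z.2, z.1)))
      => //.
    apply: (measurableT_comp mk); apply/measurable_fun_pairP.
    by split; [exact: measurable_snd|exact: measurable_fst].
  - exact: measurable_cst.
  - move=> v Qv'; apply: (le_trans (cube_shift_estimate p1 wg OmE iW iG
      (Qv v Qv'))).
    rewrite -/c lee_wpmul2l ?lee_fin//.
    apply: (le_trans (lee_sum _ (fun i _ => GI i))).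
    rewrite (eq_bigr (fun=> 1%:E * I)%E); last by move=> *; rewrite mul1e.
    by rewrite -ge0_sume_distrl// sumEFin sumr_const card_ord.
have e0 : (0 <= (2 / eps ^+ N)%:E :> \bar R)%E by rewrite lee_fin divr_ge0//
  ltW.
move=> /(lee_wpmul2l e0); rewrite !muleA -!EFinM.
have eN0 : eps ^+ N != 0 by rewrite gt_eqF.
rewrite (_ : 2 / eps ^+ N * (eps ^+ N / 2) = 1); last by field.
rewrite mul1e (_ : 2 / eps ^+ N * eps ^+ N = 2); last by field.
rewrite (_ : 2 * c * N%:R = 2 * N%:R * N%:R `^ p * 2 `^ p * eps `^ p)//.
by rewrite /c; ring.
Qed.

End faber_krahn.

(** * De Giorgi's iteration *)

Section iteration.
Context {R : realType} {N : nat}.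
Implicit Types (x y : 'rV[R]_N) (w : 'rV[R]_N -> R) (E : set 'rV[R]_N).
Notation mu := (lebesgue_rV N).

(** The constant of [faber_krahn] without its factor eps^p. *)
Definition fk_const (p : R) : R := 2 * N%:R * N%:R `^ p * 2 `^ p.

Lemma cubeS y (s t : R) : s <= t -> cube y s `<=` cube y t.
Proof. by move=> st x xs i; apply: lt_le_trans st; exact: xs. Qed.

Lemma Caccioppoli_measurable (p gamma : R) E w :
  Caccioppoli p gamma E w -> measurable_fun E w.
Proof. by case=> Dw [[]]. Qed.

Lemma measurable_powR_norm (p : R) (D : set 'rV[R]_N) w : measurable_fun D w ->
  measurable_fun D (fun x => (`|w x| `^ p)%:E).
Proof.
move=> mw; apply/measurable_EFinP; apply:
  (measurableT_comp (measurable_powR p)).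
exact: measurableT_comp.
Qed.

(** Faber-Krahn at radius rho + eps followed by the Caccioppoli inequality
    between rho + eps and r: the gain is the ratio of the averaging scale to
    the gap left between the cubes. *)
Lemma de_giorgi_step E w y (p gamma rho eps r : R) : 1 < p -> 0 < gamma ->
  open E -> Caccioppoli p gamma E w -> 0 < rho -> 0 < eps -> rho + eps < r ->
  cube y r `<=` E ->
  (mu (cube y (rho + eps) `&` [set x | w x != 0%R]) <= (eps ^+ N / 2)%:E)%E ->
  (\int[mu]_(x in cube y rho) (`|w x| `^ p)%:E <=
   (fk_const p * gamma * (eps / (r - (rho + eps))) `^ p)%:E *
     \int[mu]_(x in cube y r) (`|w x| `^ p)%:E)%E.
Proof.
move=> p1 gamma0 oE [Dw wg cac] rho0 eps0 rer rE small.
have C0 : 0 <= fk_const p by rewrite /fk_const !mulr_ge0// powR_ge0.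
apply: le_trans (faber_krahn p1 eps0 oE wg _ small) _.
  apply: subset_trans rE => x xb j; have /andP[] := xb j.
  by rewrite !mxE ltr_distl => ? ?; apply/andP; split; lra.
have re0 : 0 < rho + eps by rewrite addr_gt0.
have k0 : 0 <= fk_const p * eps `^ p by rewrite mulr_ge0// powR_ge0.
apply: le_trans (lee_wpmul2l _ (cac y (rho + eps) r re0 rer rE)) _.
  by rewrite lee_fin.
rewrite muleA -EFinM lee_wpmul2r//.
  by apply: integral_ge0 => x _; rewrite lee_fin powR_ge0.
rewrite lee_fin -/(fk_const p).
have d0 : 0 < r - (rho + eps) by rewrite subr_gt0.
rewrite [in leRHS]powRM ?(ltW eps0) ?invr_ge0 ?(ltW d0)//.
rewrite powR_inv ?(ltW d0)//.
by rewrite le_eqVlt; apply/orP; left; apply/eqP; ring.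
Qed.

(** The factor 2^-p makes up for the halving of the gaps between levels in
    Chebyshev's inequality, the factor 2^-N for the halving of the cubes over
    which increments are averaged. *)
Definition decay_rate (p : R) : R := (2 `^ p)^-1 * (2 ^+ N)^-1.

(** The averaging scale will be the fraction lam of the gap between two cubes;
    lam <= 1/2 keeps at least half of that gap for the Caccioppoli inequality,
    which is where the factor 2 comes from. *)
Lemma step_ratio (p gamma : R) : 1 < p -> 0 < gamma ->
  exists2 lam : R, 0 < lam <= 2^-1 &
    fk_const p * gamma * (2 * lam) `^ p <= decay_rate p.
Proof.
move=> p1 gamma0; have p0 : 0 < p := lt_trans ltr01 p1.
have eta0 : 0 < decay_rate p.
  by rewrite /decay_rate mulr_gt0 ?invr_gt0 ?powR_gt0 ?exprn_gt0.
have C0 : 0 <= fk_const p by rewrite /fk_const !mulr_ge0// powR_ge0.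
pose C := fk_const p * gamma + 1.
have C1 : 0 < C by rewrite ltr_wpDl// mulr_ge0// ltW.
pose q := (decay_rate p / C) `^ p^-1.
have q0 : 0 < q by rewrite powR_gt0// divr_gt0.
exists (Num.min 2^-1 (q / 2)).
  by rewrite lt_min invr_gt0 ltr0n divr_gt0//= ge_min lexx.
have : (2 * Num.min 2^-1 (q / 2)) `^ p <= decay_rate p / C.
  have -> : decay_rate p / C = q `^ p.
    by rewrite /q -powRrM mulVf ?gt_eqF// powRr1// divr_ge0// ltW.
  apply: ge0_ler_powR; rewrite ?nnegrE ?(ltW p0) ?(ltW q0)//.
    by rewrite mulr_ge0// le_min invr_ge0 ler0n divr_ge0// ltW.
  by rewrite mulrC -ler_pdivlMr// ge_min lexx orbT.
rewrite ler_pdivlMr// => H; apply: le_trans H;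
  rewrite mulrC ler_wpM2l ?powR_ge0//.
by rewrite /C lerDl.
Qed.

Definition geo_radius (rho r : R) (n : nat) : R := rho + (r - rho) / 2 ^+ n.

Lemma geo_radiusB rho r n : geo_radius rho r n - geo_radius rho r n.+1 =
  (r - rho) / 2 ^+ n.+1.
Proof. by rewrite /geo_radius exprS; field; rewrite expf_neq0. Qed.

Lemma decay_rate_pow (p : R) n :
  decay_rate p ^+ n * (2 ^+ n) `^ p = (2 ^+ n) ^- N.
Proof.
have two0 : 0 <= 2 :> R by [].
rewrite (powR_exprn p n two0) /decay_rate exprMn mulrAC !exprVn mulVf
  ?mul1r -?exprM 1?mulnC//.
Qed.

(** The integral of |w_n|^p bounds the measure of the support of w_(n+1) by
    Chebyshev's inequality. The prescribed decay of the former keeps the latter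
    below the threshold of [de_giorgi_step], which in turn gives the decay at
    the next stage. *)
Lemma de_giorgi_iteration (p gamma : R) : 1 < p -> 0 < gamma ->
  exists2 c0 : R, 0 < c0 &
  forall E y (rho r kappa : R) (w : nat -> 'rV[R]_N -> R), open E ->
    0 < rho -> rho < r -> 0 < kappa -> cube y r `<=` E ->
    (forall n, Caccioppoli p gamma E (w n)) ->
    (forall n x, `|w n.+1 x| <= `|w n x|) ->
    (forall n x, w n.+1 x != 0 -> kappa / 2 ^+ n <= `|w n x|) ->
    (\int[mu]_(x in cube y r) (`|w 0%N x| `^ p)%:E <=
      (c0 * kappa `^ p * (r - rho) ^+ N)%:E)%E ->
    forall n, (\int[mu]_(x in cube y rho) (`|w n x| `^ p)%:E <=
      (decay_rate p ^+ n * (c0 * kappa `^ p * (r - rho) ^+ N))%:E)%E.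
Proof.
move=> p1 gamma0; have p0 : 0 < p := lt_trans ltr01 p1.
have [lam /andP[lam0 lam2] Hlam] := step_ratio p1 gamma0.
(* the value for which Chebyshev's bound on the support is exactly the
   threshold of the step *)
pose c0 := (lam / 2) ^+ N / 2.
have c00 : 0 < c0 by rewrite divr_gt0// exprn_gt0// divr_gt0.
exists c0 => // E y rho r kappa w oE rho0 rr kappa0 rE cac wle wsupp w0 n.
have eta0 : 0 < decay_rate p.
  by rewrite /decay_rate mulr_gt0 ?invr_gt0 ?powR_gt0 ?exprn_gt0.
set M := c0 * kappa `^ p * (r - rho) ^+ N in w0 *.
have mE : measurable E := open_measurable_rV oE.
pose rad := geo_radius rho r.
have rad_rho m : rho < rad m by rewrite ltrDl divr_gt0 ?subr_gt0// exprn_gt0.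
have rad0 m : 0 < rad m := lt_trans rho0 (rad_rho m).
have radS m : rad m.+1 < rad m.
  by rewrite -subr_gt0 geo_radiusB divr_gt0 ?subr_gt0// exprn_gt0.
have rad_r m : rad m <= r.
  elim: m => [|m IH]; first by rewrite /rad /geo_radius expr0 divr1 addrC subrK.
  by rewrite (le_trans _ IH)// ltW.
have radE m : cube y (rad m) `<=` E by apply: subset_trans rE; exact: cubeS.
have mwp m s : s <= r -> measurable_fun (cube y s)
  (fun x => (`|w m x| `^ p)%:E).
  move=> sr; apply: measurable_powR_norm.
  apply: measurable_funS (Caccioppoli_measurable (cac m)) => //.
  by apply: subset_trans rE; exact: cubeS.
have mcube s : measurable (cube y s) := measurable_cube y s.
have wp0 m s : (0 <= \int[mu]_(x in cube y s) (`|w m x| `^ p)%:E)%E.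
  by apply: integral_ge0 => x _; rewrite lee_fin powR_ge0.
suff Y m : (\int[mu]_(x in cube y (rad m)) (`|w m x| `^ p)%:E <=
    (decay_rate p ^+ m * M)%:E)%E.
  apply: le_trans (Y n); apply: ge0_subset_integral => //.
  - exact: mwp.
  - by apply: cubeS; exact: ltW.
elim: m => [|m IH].
  by rewrite expr0 mul1r (_ : rad 0%N = r)//
    /rad /geo_radius expr0 divr1 addrC subrK.
pose s := (r - rho) / 2 ^+ m.+1.
have s0 : 0 < s by rewrite divr_gt0 ?subr_gt0// exprn_gt0.
have radsE : rad m = rad m.+1 + s by rewrite /s -geo_radiusB addrC subrK.
pose eps := lam * s.
have eps0 : 0 < eps by rewrite mulr_gt0.
have epss : eps <= s / 2 by rewrite /eps mulrC ler_wpM2l// ltW.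
have rer : rad m.+1 + eps < rad m by rewrite radsE ltrD2l; lra.
have small : (mu (cube y (rad m.+1 + eps) `&` [set x | w m.+1 x != 0%R]) <=
    (eps ^+ N / 2)%:E)%E.
  set A := _ `&` _.
  have Ac : A `<=` cube y (rad m) by move=> x [xc _]; exact: (cubeS (ltW rer)).
  have mA : measurable A.
    rewrite /A (_ : _ `&` _ = cube y (rad m.+1 + eps) `&`
      (w m.+1 @^-1` (~` [set 0])));
      last by apply/seteqP; split=> x [? /eqP].
    have mw : measurable_fun (cube y (rad m.+1 + eps)) (w m.+1).
      apply: measurable_funS (Caccioppoli_measurable (cac m.+1)) => //.
      by apply: subset_trans (radE m); exact/cubeS/ltW.
    by apply: mw => //; exact: measurableC.
  have k0 : 0 < (kappa / 2 ^+ m) `^ p by rewrite powR_gt0// divr_gt0//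
    exprn_gt0.
  have : (((kappa / 2 ^+ m) `^ p)%:E * mu A <= (decay_rate p ^+ m * M)%:E)%E.
    apply: le_trans IH.
    apply: (@le_trans _ _ (\int[mu]_(x in A) (`|w m x| `^ p)%:E)%E); last first.
      by apply: ge0_subset_integral => //; exact: mwp.
    rewrite -integral_cst//; apply: ge0_le_integral => //.
    - by move=> x _; rewrite lee_fin ltW.
    - by apply: measurable_funS (mwp m _ (rad_r m)).
    - move=> x [_ /= wx]; rewrite lee_fin; apply: ge0_ler_powR;
        rewrite ?nnegrE ?(ltW p0)//; last exact: wsupp.
      by rewrite divr_ge0 ?exprn_ge0// ltW.
  rewrite -lee_pdivlMl// => /le_trans; apply; rewrite -EFinM lee_fin.
  rewrite powRM ?invr_ge0 ?exprn_ge0 ?(ltW kappa0)//.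
  rewrite powR_inv ?exprn_ge0//.
  have kp : kappa `^ p != 0 by rewrite gt_eqF// powR_gt0.
  have tp : (2 ^+ m) `^ p != 0 :> R by rewrite gt_eqF// powR_gt0// exprn_gt0.
  have -> : (kappa `^ p / (2 ^+ m) `^ p)^-1 * (decay_rate p ^+ m * M) =
      (decay_rate p ^+ m * (2 ^+ m) `^ p) * (c0 * (r - rho) ^+ N).
    by rewrite /M; field; rewrite kp tp.
  rewrite decay_rate_pow /c0 /eps /s exprS.
  rewrite le_eqVlt; apply/orP; left; apply/eqP.
  rewrite !exprMn !exprVn !exprMn; field.
  by rewrite !expf_neq0.
have := de_giorgi_step p1 gamma0 oE (cac m.+1) (rad0 m.+1) eps0 rer
  (radE m) small.
move=> /le_trans; apply.
have ratio : eps / (rad m - (rad m.+1 + eps)) <= 2 * lam.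
  have d0 : 0 < rad m - (rad m.+1 + eps) by rewrite subr_gt0.
  rewrite ler_pdivrMr// radsE -mulrA /eps [leRHS]mulrCA ler_wpM2l ?(ltW lam0)//.
  by rewrite -/eps; lra.
apply: (@le_trans _ _ ((decay_rate p)%:E *
    \int[mu]_(x in cube y (rad m)) (`|w m.+1 x| `^ p)%:E)%E).
  rewrite lee_wpmul2r// lee_fin; apply: le_trans Hlam.
  have C0 : 0 <= fk_const p by rewrite /fk_const !mulr_ge0// powR_ge0.
  have q0 : 0 <= eps / (rad m - (rad m.+1 + eps)).
    by rewrite divr_ge0 ?(ltW eps0)// subr_ge0 ltW.
  rewrite ler_wpM2l ?mulr_ge0 ?(ltW gamma0)//.
  by apply: ge0_ler_powR; rewrite ?nnegrE ?(ltW p0) ?q0 ?mulr_ge0 ?(ltW lam0).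
rewrite exprS -mulrA [leRHS]EFinM; apply: lee_wpmul2l.
  by rewrite lee_fin ltW.
apply: le_trans IH; apply: ge0_le_integral => //.
- exact: mwp.
- exact: mwp.
- move=> x _; rewrite lee_fin; apply: ge0_ler_powR; rewrite ?nnegrE ?(ltW p0)//.
Qed.

End iteration.

(** * Critical estimates *)

Section truncations.
Context {R : realType} {N : nat}.
Implicit Types (x y : 'rV[R]_N) (u w f : 'rV[R]_N -> R) (E : set 'rV[R]_N).
Notation mu := (lebesgue_rV N).

(** An integral below every term of a geometric sequence is 0. *)
Lemma ae_eq0_of_geometric y (p q M rho : R) f : 0 < p -> 0 < q -> q < 1 ->
  measurable_fun (cube y rho) f ->
  (forall n, \int[mu]_(x in cube y rho) (`|f x| `^ p)%:E <= (q ^+ n * M)%:E)%E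
    ->
  {ae mu, forall x, cube y rho x -> f x = 0}.
Proof.
move=> p0 q0 q1 mf H; set D := cube y rho.
have mD : measurable D := measurable_cube y rho.
have mfp := measurable_powR_norm p mf.
have I0 : (0 <= \int[mu]_(x in D) (`|f x| `^ p)%:E)%E.
  by apply: integral_ge0 => x _; rewrite lee_fin powR_ge0.
have I_fin : (\int[mu]_(x in D) (`|f x| `^ p)%:E)%E \is a fin_num.
  by rewrite ge0_fin_numE// (le_lt_trans (H 0%N))// ltry.
have I_le0 : fine (\int[mu]_(x in D) (`|f x| `^ p)%:E)%E <= 0.
  have cv : q ^+ n * M @[n --> \oo] --> 0 * M.
    apply: cvgMr_tmp; apply: cvg_expr; rewrite ger0_norm// ltW//.
  rewrite mul0r in cv.
  rewrite -(cvg_lim _ cv)//; apply: limr_ge; first by apply/cvg_ex; exists 0.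
  by apply: nearW => n; rewrite -lee_fin fineK.
have Ieq0 : (\int[mu]_(x in D) `|(`|f x| `^ p)%:E| = 0)%E.
  rewrite (eq_integral (fun x => (`|f x| `^ p)%:E)); last first.
    by move=> x _; rewrite gee0_abs// lee_fin powR_ge0.
  by apply/le_anti/andP; split=> //; rewrite -(fineK I_fin) lee_fin.
have /(_ Ieq0) := (ae_eq_integral_abs mu mD mfp).1.
apply: filterS => x /[apply] /= -[] /eqP.
by rewrite powR_eq0 normr_eq0 => /andP[/eqP].
Qed.

Lemma decay_rate_itv (p : R) : 1 < p -> 0 < @decay_rate R N p < 1.
Proof.
move=> p1; rewrite /decay_rate mulr_gt0 ?invr_gt0 ?powR_gt0 ?exprn_gt0//=.
have p2 : 2 `^ 1 <= 2 `^ p :> R by apply: ler_powR; rewrite ?ler1n// ltW.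
rewrite powRr1// in p2.
have N1 : 1 <= 2 ^+ N :> R by rewrite exprn_ege1// ler1n.
rewrite -invfM invf_lt1 ?mulr_gt0 ?powR_gt0 ?exprn_gt0//.
by nra.
Qed.

(** A function below all the truncations inherits the decay of their
    integrals. *)
Lemma de_giorgi_vanishing (p gamma : R) : 1 < p -> 0 < gamma ->
  exists2 c0 : R, 0 < c0 &
  forall E y (rho r kappa : R) (w : nat -> 'rV[R]_N -> R) f, open E ->
    0 < rho -> rho < r -> 0 < kappa -> cube y r `<=` E ->
    (forall n, Caccioppoli p gamma E (w n)) ->
    (forall n x, `|w n.+1 x| <= `|w n x|) ->
    (forall n x, w n.+1 x != 0 -> kappa / 2 ^+ n <= `|w n x|) ->
    measurable_fun E f -> (forall n x, `|f x| <= `|w n x|) ->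
    (\int[mu]_(x in cube y r) (`|w 0%N x| `^ p)%:E <=
      (c0 * kappa `^ p * (r - rho) ^+ N)%:E)%E ->
    {ae mu, forall x, cube y rho x -> f x = 0}.
Proof.
move=> p1 gamma0; have p0 : 0 < p := lt_trans ltr01 p1.
have [c0 c00 H] := @de_giorgi_iteration R N p gamma p1 gamma0.
exists c0 => // E y rho r kappa w f oE rho0 rr kappa0 rE cac wle wsupp mf fw w0.
have {}H := H E y rho r kappa w oE rho0 rr kappa0 rE cac wle wsupp w0.
have /andP[q0 q1] := decay_rate_itv p1.
have cE : cube y rho `<=` E by apply: subset_trans rE; apply: cubeS; exact: ltW.
have mE := open_measurable_rV oE.
have mfc : measurable_fun (cube y rho) f by apply: measurable_funS mf.
apply: (@ae_eq0_of_geometric y p (@decay_rate R N p)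
  (c0 * kappa `^ p * (r - rho) ^+ N)
  rho f p0 q0 q1 mfc) => n.
apply: le_trans (H n); apply: ge0_le_integral => //.
- exact: measurable_cube.
- exact: measurable_powR_norm.
- apply: measurable_powR_norm.
  by apply: measurable_funS (Caccioppoli_measurable (cac n)).
- move=> x _; rewrite lee_fin; apply: ge0_ler_powR; rewrite ?nnegrE ?(ltW p0)//.
Qed.

(** The levels rise from k / 2 to k; the gap between consecutive levels bounds
    a truncation from below wherever the next one is positive. *)
Lemma sup_critical (p gamma : R) : 1 < p -> 0 < gamma ->
  exists2 c0 : R, 0 < c0 &
  forall E y (rho r k : R) u, open E -> DG_pos p gamma E u ->
    0 < rho -> rho < r -> 0 < k -> cube y r `<=` E ->
    (\int[mu]_(x in cube y r) (Num.max (u x - k / 2) 0 `^ p)%:E <=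
      (c0 * k `^ p * (r - rho) ^+ N)%:E)%E ->
    {ae mu, forall x, cube y rho x -> u x <= k}.
Proof.
move=> p1 gamma0; have p0 : 0 < p := lt_trans ltr01 p1.
have [c0 c00 H] := de_giorgi_vanishing p1 gamma0.
exists (c0 * 4^-1 `^ p); first by rewrite mulr_gt0// powR_gt0.
move=> E y rho r k u oE [_ cac] rho0 rr k0 rE w0.
pose kn n := k - k / 2 / 2 ^+ n.
have knS n : kn n.+1 - kn n = k / 4 / 2 ^+ n.
  by rewrite /kn exprS; field; rewrite expf_neq0.
have kn_le n : kn n <= k by rewrite /kn gerBl !divr_ge0 ?exprn_ge0// ltW.
have knS_le n : kn n <= kn n.+1.
  by rewrite -subr_ge0 knS !divr_ge0 ?exprn_ge0// ltW.
pose w n : 'rV[R]_N -> R := (fun x => u x - kn n)^\+.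
have wE n x : w n x = Num.max (u x - kn n) 0 by [].
have w_ge0 n x : 0 <= w n x by rewrite wE le_max lexx orbT.
have mu_ : measurable_fun E (fun x => Num.max (u x - k) 0).
  exact: (Caccioppoli_measurable (cac k)).
have : {ae mu, forall x, cube y rho x -> Num.max (u x - k) 0 = 0}.
  apply: (H E y rho r (k / 4) w) => //; first by rewrite divr_gt0.
  - by move=> n; exact: cac.
  - move=> n x; rewrite !ger0_norm// !wE ge_max !le_max lexx !orbT andbT.
    by rewrite lerD2l lerN2 knS_le.
  - move=> n x; rewrite (ger0_norm (w_ge0 _ _)) !wE -knS.
    case: (leP (u x - kn n.+1) 0) => [_|uk _]; first by rewrite eqxx.
    by rewrite le_max; apply/orP; left; rewrite lerD2r; lra.
  - move=> n x; rewrite (ger0_norm (w_ge0 n x)) ger0_norm;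
      last by rewrite le_max lexx orbT.
    rewrite wE.
    by rewrite ge_max !le_max lexx !orbT andbT lerD2l lerN2 kn_le.
  - rewrite (eq_integral (fun x => (Num.max (u x - k / 2) 0 `^ p)%:E)).
      by move: w0; rewrite powRM ?invr_ge0 ?(ltW k0)// [k `^ p * _]mulrC mulrA.
    by move=> x _; rewrite ger0_norm// wE /kn expr0 divr1
      (_ : k - k / 2 = k / 2)//; field.
apply: filterS => x /[apply] /eqP; rewrite eq_le => /andP[+ _].
by rewrite ge_max subr_le0 => /andP[].
Qed.

(** The scheme of [sup_critical] for the levels falling from k to k / 2. *)
Lemma inf_critical (p gamma : R) : 1 < p -> 0 < gamma ->
  exists2 c0 : R, 0 < c0 &
  forall E y (rho r k : R) u, open E -> DG_neg p gamma E u ->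
    0 < rho -> rho < r -> 0 < k -> cube y r `<=` E ->
    (\int[mu]_(x in cube y r) (Num.max (k - u x) 0 `^ p)%:E <=
      (c0 * k `^ p * (r - rho) ^+ N)%:E)%E ->
    {ae mu, forall x, cube y rho x -> k / 2 <= u x}.
Proof.
move=> p1 gamma0; have p0 : 0 < p := lt_trans ltr01 p1.
have [c0 c00 H] := de_giorgi_vanishing p1 gamma0.
exists (c0 * 4^-1 `^ p); first by rewrite mulr_gt0// powR_gt0.
move=> E y rho r k u oE [_ cac] rho0 rr k0 rE w0.
pose kn n := k / 2 + k / 2 / 2 ^+ n.
have knS n : kn n - kn n.+1 = k / 4 / 2 ^+ n.
  by rewrite /kn exprS; field; rewrite expf_neq0.
have kn_ge n : k / 2 <= kn n by rewrite /kn lerDl !divr_ge0 ?exprn_ge0// ltW.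
have knS_le n : kn n.+1 <= kn n.
  by rewrite -subr_ge0 knS !divr_ge0 ?exprn_ge0// ltW.
pose w n : 'rV[R]_N -> R := (fun x => u x - kn n)^\-.
have wE n x : w n x = Num.max (kn n - u x) 0 by rewrite /w /funrneg opprB.
have w_ge0 n x : 0 <= w n x by rewrite wE le_max lexx orbT.
have fE : (fun x => Num.max (k / 2 - u x) 0) = (fun x => u x - k / 2)^\-.
  by apply/funext => x; rewrite /funrneg opprB.
have mu_ : measurable_fun E (fun x => Num.max (k / 2 - u x) 0).
  by rewrite fE; exact: (Caccioppoli_measurable (cac (k / 2))).
have : {ae mu, forall x, cube y rho x -> Num.max (k / 2 - u x) 0 = 0}.
  apply: (H E y rho r (k / 4) w) => //; first by rewrite divr_gt0.
  - by move=> n; exact: cac.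
  - move=> n x; rewrite !ger0_norm// !wE ge_max !le_max lexx !orbT andbT.
    by rewrite lerD2r knS_le.
  - move=> n x; rewrite (ger0_norm (w_ge0 _ _)) !wE -knS.
    case: (leP (kn n.+1 - u x) 0) => [_|uk _]; first by rewrite eqxx.
    by rewrite le_max; apply/orP; left; lra.
  - move=> n x; rewrite (ger0_norm (w_ge0 n x)) ger0_norm;
      last by rewrite le_max lexx orbT.
    rewrite wE.
    by rewrite ge_max !le_max lexx !orbT andbT lerD2r kn_ge.
  - rewrite (eq_integral (fun x => (Num.max (k - u x) 0 `^ p)%:E)).
      by move: w0; rewrite powRM ?invr_ge0 ?(ltW k0)// [k `^ p * _]mulrC mulrA.
    by move=> x _; rewrite ger0_norm// wE /kn expr0 divr1 -splitr.
apply: filterS => x /[apply] /eqP; rewrite eq_le => /andP[+ _].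
by rewrite ge_max subr_le0 => /andP[].
Qed.

End truncations.

(** * Upper bound by an integral of a power *)

Section bounds.
Context {R : realType} {N : nat}.
Implicit Types (x y : 'rV[R]_N) (u : 'rV[R]_N -> R) (E : set 'rV[R]_N).
Notation mu := (lebesgue_rV N).

Lemma DG_pos_measurable (p gamma : R) E u : DG_pos p gamma E u ->
  measurable_fun E u.
Proof. by case=> -[[]]. Qed.

Lemma measurable_powR_fun (s : R) (D : set 'rV[R]_N) u : measurable_fun D u ->
  measurable_fun D (fun x => (u x `^ s)%:E).
Proof.
by move=> mu_; apply/measurable_EFinP; apply:
  (measurableT_comp (measurable_powR s)).
Qed.

Lemma powRD_gt0 (t a b : R) : 0 < t -> t `^ (a + b) = t `^ a * t `^ b.
Proof. by move=> t0; rewrite powRD// (gt_eqF t0) implybT. Qed.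

Lemma powR_le_of_ge (l t p sigma : R) : 0 < l -> l <= t -> p <= sigma ->
  t `^ p <= l `^ (p - sigma) * t `^ sigma.
Proof.
move=> l0 lt ps; have t0 : 0 < t := lt_le_trans l0 lt.
rewrite -opprB powRN ler_pdivlMl ?powR_gt0//.
have -> : t `^ sigma = t `^ (sigma - p) * t `^ p by rewrite -powRD_gt0// subrK.
rewrite ler_wpM2r ?powR_ge0//.
by apply: ge0_ler_powR; rewrite ?nnegrE ?subr_ge0 ?(ltW l0) ?(ltW t0).
Qed.

Lemma powR_le_of_le (t M p sigma : R) : 0 < t -> t <= M -> sigma <= p ->
  t `^ p <= M `^ (p - sigma) * t `^ sigma.
Proof.
move=> t0 tM sp; have M0 : 0 < M := lt_le_trans t0 tM.
have -> : t `^ p = t `^ (p - sigma) * t `^ sigma by rewrite -powRD_gt0// subrK.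
rewrite ler_wpM2r ?powR_ge0//.
by apply: ge0_ler_powR; rewrite ?nnegrE ?subr_ge0 ?(ltW t0) ?(ltW M0).
Qed.

(** The first truncation lives where u > k / 2, so u^p may be replaced there
    by any majorant v; the powers u^sigma will enter in this way. *)
Lemma sup_bound_of_le (p gamma : R) : 1 < p -> 0 < gamma ->
  exists2 c0 : R, 0 < c0 &
  forall E y (rho r k : R) u (v : 'rV[R]_N -> R),
    open E -> DG_pos p gamma E u ->
    0 < rho -> rho < r -> 0 < k -> cube y r `<=` E ->
    measurable_fun E v -> (forall x, 0 <= v x) ->
    {ae mu, forall x, cube y r x -> k / 2 < u x -> u x `^ p <= v x} ->
    (\int[mu]_(x in cube y r) (v x)%:E <= (c0 * k `^ p * (r - rho) ^+ N)%:E)%E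
      ->
    {ae mu, forall x, cube y rho x -> u x <= k}.
Proof.
move=> p1 gamma0; have p0 : 0 < p := lt_trans ltr01 p1.
have [c0 c00 H] := @sup_critical R N p gamma p1 gamma0.
exists c0 => // E y rho r k u v oE dg rho0 rr k0 rE mv v0 uv vI.
have mE := open_measurable_rV oE.
apply: (H E y rho r k u) => //; apply: le_trans vI.
have mcube := measurable_cube y r.
apply: ae_ge0_le_integral => //.
- by move=> x _; rewrite lee_fin powR_ge0.
- apply: measurable_powR_fun.
  apply: measurable_funS (Caccioppoli_measurable (dg.2 (k / 2))) => //.
- by move=> x _; rewrite lee_fin.
- by apply/measurable_EFinP; apply: measurable_funS mv.
- apply: filterS uv => x uvx xc; rewrite lee_fin.
  case: (leP (u x - k / 2) 0) => [_|uk]; first by rewrite powR0 ?gt_eqF.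
  apply: le_trans (uvx xc _); last by rewrite -subr_gt0.
  have uge : u x - k / 2 <= u x by rewrite gerBl divr_ge0// ltW.
  by apply: ge0_ler_powR; rewrite ?nnegrE ?(ltW p0) ?(ltW uk)
    ?(le_trans (ltW uk) uge).
Qed.

Lemma closed_cube_Lp E y (p s : R) u : 0 < p -> Lp_loc p E u -> open E ->
  closed_box (y - const_mx s) (y + const_mx s) `<=` E ->
  (\int[mu]_(x in cube y s) (`|u x| `^ p)%:E < +oo)%E.
Proof.
move=> p0 [mu_ uK] oE KE; have mE := open_measurable_rV oE.
apply: le_lt_trans (uK _ (compact_closed_box (a := y - const_mx s)
  (b := y + const_mx s)) KE).
have mK := measurable_closed_box (y - const_mx s) (y + const_mx s).
apply: ge0_subset_integral => //.
- exact: measurable_cube.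
- by apply: measurable_powR_norm; apply: measurable_funS mu_.
- rewrite cube_box => x xO j; have /andP[? ?] := xO j; by rewrite !ltW.
Qed.

(** On a slightly smaller cube |u|^p has a finite integral, so the critical
    estimate applies once the level is large enough. *)
Lemma locally_bounded_above (p gamma : R) E y (rho r : R) u :
  1 < p -> 0 < gamma -> open E -> DG_pos p gamma E u ->
  0 < rho -> rho < r -> cube y r `<=` E ->
  exists2 M, 0 < M & {ae mu, forall x, cube y rho x -> u x <= M}.
Proof.
move=> p1 gamma0 oE dg rho0 rr rE; have p0 : 0 < p := lt_trans ltr01 p1.
have [c0 c00 H] := sup_bound_of_le p1 gamma0.
pose s := (rho + r) / 2.
have rs : rho < s by rewrite /s; lra.
have sr : s < r by rewrite /s; lra.
have sE : closed_box (y - const_mx s) (y + const_mx s) `<=` E.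
  apply: subset_trans rE => x xb j; have /andP[] := xb j.
  by rewrite !mxE ltr_distl => ? ?; apply/andP; split; lra.
have I_lty := closed_cube_Lp p0 dg.1.1 oE sE.
have I0 : (0 <= \int[mu]_(x in cube y s) (`|u x| `^ p)%:E)%E.
  by apply: integral_ge0 => x _; rewrite lee_fin powR_ge0.
have I_fin : (\int[mu]_(x in cube y s) (`|u x| `^ p)%:E)%E \is a fin_num.
  by rewrite ge0_fin_numE.
set I := (\int[mu]_(x in cube y s) (`|u x| `^ p)%:E)%E in I_lty I0 I_fin.
pose d := c0 * (s - rho) ^+ N.
have d0 : 0 < d by rewrite mulr_gt0// exprn_gt0// subr_gt0.
have Id0 : 0 < (fine I + 1) / d by rewrite divr_gt0// ltr_wpDl// fine_ge0.
(* adding 1 keeps the level positive if the integral is 0 *)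
pose M := ((fine I + 1) / d) `^ p^-1.
have M0 : 0 < M by rewrite powR_gt0.
exists M => //.
apply: (H E y rho s M u (fun x => `|u x| `^ p)) => //.
- by apply: subset_trans rE; apply: cubeS; exact: ltW.
- apply: (measurableT_comp (measurable_powR p)); apply: measurableT_comp => //.
  exact: DG_pos_measurable dg.
- by apply: aeW => x _ Mu; rewrite gtr0_norm// (lt_trans _ Mu)// divr_gt0.
- rewrite -/I -(fineK I_fin) lee_fin.
  have -> : M `^ p = (fine I + 1) / d by rewrite /M -powRrM mulVf ?gt_eqF//
    powRr1// ltW.
  rewrite mulrAC -/d mulrC divfK ?gt_eqF//.
  by rewrite lerDl.
Qed.

Lemma sup_bound_high (p gamma sigma : R) : 1 < p -> 0 < gamma -> p <= sigma ->
  exists2 c : R, 0 < c &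
  forall E y (rho r k : R) u, open E -> DG_pos p gamma E u ->
    0 < rho -> rho < r -> 0 < k -> cube y r `<=` E ->
    (\int[mu]_(x in cube y r) (u x `^ sigma)%:E <=
      (c * k `^ sigma * (r - rho) ^+ N)%:E)%E ->
    {ae mu, forall x, cube y rho x -> u x <= k}.
Proof.
move=> p1 gamma0 ps; have p0 : 0 < p := lt_trans ltr01 p1.
have [c0 c00 H] := sup_bound_of_le p1 gamma0.
exists (c0 * 2^-1 `^ (sigma - p)); first by rewrite mulr_gt0// powR_gt0.
move=> E y rho r k u oE dg rho0 rr k0 rE uI.
have k20 : 0 < k / 2 by rewrite divr_gt0.
have mu_ := DG_pos_measurable dg.
have mE := open_measurable_rV oE.
apply: (H E y rho r k u (fun x => (k / 2) `^ (p - sigma) * u x `^ sigma)) => //.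
- by apply: measurable_funM => //; apply:
    (measurableT_comp (measurable_powR sigma)).
- by move=> x; rewrite mulr_ge0// powR_ge0.
- apply: aeW => x _ ku; have u0 : 0 < u x := lt_trans k20 ku.
  by apply: powR_le_of_ge => //; exact: ltW.
- rewrite (_ : (\int[mu]_(x in cube y r) _ = ((k / 2) `^ (p - sigma))%:E *
      \int[mu]_(x in cube y r) (u x `^ sigma)%:E)%E); last first.
    rewrite -ge0_integralZl//.
    - exact: measurable_cube.
    - by apply: measurable_powR_fun; apply: measurable_funS mu_.
    - by move=> x _; rewrite lee_fin powR_ge0.
    - by rewrite lee_fin powR_ge0.
  have kp0 : (0 <= ((k / 2) `^ (p - sigma))%:E :> \bar R)%E by rewrite lee_fin
    powR_ge0.
  apply: le_trans (lee_wpmul2l kp0 uI) _; rewrite -EFinM lee_fin.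
  rewrite powRM ?invr_ge0 ?(ltW k0)//.
  rewrite le_eqVlt; apply/orP; left; apply/eqP.
  transitivity (c0 * (k `^ (p - sigma) * k `^ sigma) *
     (2^-1 `^ (p - sigma) * 2^-1 `^ (sigma - p)) * (r - rho) ^+ N);
       first by ring.
  rewrite -!powRD_gt0 ?invr_gt0// subrK addrA subrK subrr powRr0 mulr1//.
Qed.

(** A bound by k B^(j+1) on one cube improves to k B^j on the next smaller one.
    The gap between these cubes shrinks like 2^-j, which costs 2^(jN) in the
    critical estimate; the choice B^sigma = 2^N pays for it exactly. The
    descent needs some bound to start from, hence the intermediate radius at
    which u is known to be bounded. *)
Lemma sup_bound_low (p gamma sigma : R) : (0 < N)%N -> 1 < p -> 0 < gamma ->
  0 < sigma -> sigma < p ->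
  exists2 c : R, 0 < c &
  forall E y (rho r k : R) u, open E -> DG_pos p gamma E u ->
    0 < rho -> rho < r -> 0 < k -> cube y r `<=` E ->
    (\int[mu]_(x in cube y r) (u x `^ sigma)%:E <=
      (c * k `^ sigma * (r - rho) ^+ N)%:E)%E ->
    {ae mu, forall x, cube y rho x -> u x <= k}.
Proof.
move=> N0 p1 gamma0 sigma0 sp; have p0 : 0 < p := lt_trans ltr01 p1.
have [c0 c00 H] := sup_bound_of_le p1 gamma0.
pose B := 2 `^ (N%:R / sigma) : R.
have B0 : 0 < B by rewrite powR_gt0.
have Bsigma : B `^ sigma = 2 ^+ N.
  by rewrite /B -powRrM divfK ?gt_eqF// powR_mulrn.
have B1 : 1 < B.
  rewrite ltNge; apply/negP => B1.
  have : B `^ sigma <= 1 `^ sigma by apply: ge0_ler_powR;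
    rewrite ?nnegrE ?(ltW sigma0) ?(ltW B0).
  rewrite Bsigma powR1 leNgt => /negP; apply.
  by rewrite exprn_egt1 ?ltr1n// -lt0n.
clearbody B.
(* the value that turns the smallness condition of each descent into an
   equality *)
pose c := c0 * B `^ (sigma - p) / 4 ^+ N.
have cpos : 0 < c by rewrite divr_gt0 ?exprn_gt0// mulr_gt0// powR_gt0.
exists c => // E y rho r k u oE dg rho0 rr k0 rE uI.
have mu_ := DG_pos_measurable dg.
have mE := open_measurable_rV oE.
pose r' := (rho + r) / 2.
have rr' : rho < r' by rewrite /r'; lra.
have r'r : r' < r by rewrite /r'; lra.
have [M M0 uM] := locally_bounded_above p1 gamma0 oE dg
  (lt_trans rho0 rr') r'r rE.
pose rad j := r' - (r' - rho) / 2 ^+ j.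
have radB j : rad j.+1 - rad j = (r - rho) / 4 / 2 ^+ j.
  by rewrite /rad /r' exprS; field; rewrite expf_neq0.
have radS j : rad j < rad j.+1.
  by rewrite -subr_gt0 radB !divr_gt0 ?exprn_gt0 ?subr_gt0.
have rad_r' j : rad j < r' by rewrite /rad gtrBl divr_gt0 ?exprn_gt0 ?subr_gt0.
have rad_ge j : rho <= rad j.
  elim: j => [|j IH]; last by rewrite (le_trans IH)// ltW.
  by rewrite /rad expr0 divr1 opprB addrC subrK.
have descend j : {ae mu, forall x, cube y (rad j.+1) x -> u x <= k * B ^+ j.+1}
  ->
    {ae mu, forall x, cube y (rad j) x -> u x <= k * B ^+ j}.
  move=> uj; have Kj0 : 0 < k * B ^+ j by rewrite mulr_gt0// exprn_gt0.
  have rjE : cube y (rad j.+1) `<=` E.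
    by apply: subset_trans rE; apply: cubeS;
      rewrite ltW// (lt_trans (rad_r' _)).
  have mcube := measurable_cube y (rad j.+1).
  have rad0 : 0 < rad j := lt_le_trans rho0 (rad_ge j).
  pose L := k * B ^+ j.+1.
  have L0 : 0 < L by rewrite mulr_gt0// exprn_gt0.
  apply: (H E y (rad j) (rad j.+1) (k * B ^+ j) u
    (fun x => L `^ (p - sigma) * u x `^ sigma)) => //.
  - by apply: measurable_funM => //; apply:
      (measurableT_comp (measurable_powR sigma)).
  - by move=> x; rewrite mulr_ge0// powR_ge0.
  - apply: filterS uj => x ux xc Ku; apply: powR_le_of_le; last exact: ltW.
      by rewrite (lt_trans _ Ku)// divr_gt0.
    exact: ux.
  - have Lp0 : (0 <= (L `^ (p - sigma))%:E :> \bar R)%E by rewrite lee_fin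
      powR_ge0.
    rewrite (_ : (\int[mu]_(x in cube y _) _ = (L `^ (p - sigma))%:E *
        \int[mu]_(x in cube y (rad j.+1)) (u x `^ sigma)%:E)%E); last first.
      rewrite -ge0_integralZl//.
      - by apply: measurable_powR_fun; apply: measurable_funS mu_.
      - by move=> x _; rewrite lee_fin powR_ge0.
    have : (\int[mu]_(x in cube y (rad j.+1)) (u x `^ sigma)%:E <=
        (c * k `^ sigma * (r - rho) ^+ N)%:E)%E.
      apply: le_trans uI; apply: ge0_subset_integral => //.
      - exact: measurable_cube.
      - by apply: measurable_powR_fun; apply: measurable_funS mu_.
      - by move=> x _; rewrite lee_fin powR_ge0.
      - by apply: cubeS; rewrite ltW// (lt_trans (rad_r' _)).
    move=> /(lee_wpmul2l Lp0)/le_trans; apply; rewrite -EFinM lee_fin radB.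
    rewrite le_eqVlt; apply/orP; left; apply/eqP.
    have b0 : 0 < B ^+ j by rewrite exprn_gt0.
    have e1 : k `^ p = k `^ (p - sigma) * k `^ sigma by rewrite -powRD_gt0//
      subrK.
    have e2 : B `^ (sigma - p) = (B `^ (p - sigma))^-1 by rewrite -powRN opprB.
    have e3 : (B ^+ j) `^ p = (B ^+ j) `^ (p - sigma) * (2 ^+ N) ^+ j.
      rewrite -Bsigma -(powR_exprn _ _ (ltW B0)).
      by rewrite -powRD_gt0// subrK.
    have e4 : ((r - rho) / 4 / 2 ^+ j) ^+ N = (r - rho) ^+ N / 4 ^+ N /
      (2 ^+ N) ^+ j.
      by rewrite !exprMn !exprVn -!exprM mulnC.
    rewrite /L /c exprS [in RHS]powRM ?(ltW k0) ?(ltW b0)// e3 e4 e2 e1.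
    rewrite !powRM ?mulr_ge0 ?(ltW k0) ?(ltW B0) ?(ltW b0)//; field.
    by rewrite !expf_neq0// gt_eqF// powR_gt0.
have [J MJ] : exists J : nat, M <= k * B ^+ J.
  have cv : (B^-1) ^+ n @[n --> \oo] --> 0.
    by apply: cvg_expr; rewrite gtr0_norm ?invr_gt0// invf_lt1.
  have /cvgr0_norm_le/(_ _ (divr_gt0 k0 M0))[J _ HJ] := cv.
  exists J; have := HJ J (leqnn J).
  rewrite ger0_norm ?exprn_ge0 ?invr_ge0 ?(ltW B0)// exprVn ler_pdivlMr//.
  by rewrite ler_pdivrMl ?exprn_gt0// mulrC.
have start : {ae mu, forall x, cube y (rad J) x -> u x <= k * B ^+ J}.
  apply: filterS uM => x ux xc; apply: le_trans MJ; apply: ux.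
  by apply: cubeS xc; exact: ltW.
have : {ae mu, forall x, cube y (rad 0%N) x -> u x <= k * B ^+ 0}.
  by elim: J {MJ} start => // J IH start; apply: IH; exact: descend.
apply: filterS => x; rewrite expr0 mulr1 /rad expr0 divr1 opprB addrC subrK.
exact.
Qed.

End bounds.

(** * The two one-sided estimates *)

Section inf_bound.
Context {R : realType} {N : nat}.
Implicit Types (x y : 'rV[R]_N) (u : 'rV[R]_N -> R) (E : set 'rV[R]_N).
Notation mu := (lebesgue_rV N).

Lemma sup_bound (p gamma sigma : R) : (0 < N)%N -> 1 < p -> 0 < gamma ->
  0 < sigma ->
  exists2 c : R, 0 < c &
  forall E y (rho r k : R) u, open E -> DG_pos p gamma E u ->
    0 < rho -> rho < r -> 0 < k -> cube y r `<=` E ->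
    (\int[mu]_(x in cube y r) (u x `^ sigma)%:E <=
      (c * k `^ sigma * (r - rho) ^+ N)%:E)%E ->
    {ae mu, forall x, cube y rho x -> u x <= k}.
Proof.
move=> N0 p1 gamma0 sigma0; have [sp|ps] := ltP sigma p.
  exact: sup_bound_low.
exact: sup_bound_high.
Qed.

Lemma measurable_powR_inve (tau : R) (D : set 'rV[R]_N) u :
  measurable_fun D u -> measurable_fun D (fun x => ((u x `^ tau)%:E^-1)%E).
Proof.
move=> mu_.
have mJ : measurable_fun setT (fun t : measurableTypeR R =>
  ((t `^ tau)%:E^-1)%E).
  rewrite (_ : (fun t => _) = (fun t : measurableTypeR R =>
     if t `^ tau == 0 then +oo%E else (t `^ (- tau))%:E)); last first.
    by apply/funext => t; rewrite inver powRN.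
  apply: measurable_fun_ifT => //; last first.
    by apply/measurable_EFinP; exact: measurable_powR.
  apply: measurable_fun_eqr => //; exact: measurable_powR.
exact: (measurableT_comp mJ).
Qed.

(** Where 0 <= u < k, both (k - u)^p <= k^p and 1 <= k^tau u^(-tau). *)
Lemma inf_bound (p gamma tau : R) : 1 < p -> 0 < gamma -> 0 < tau ->
  exists2 c : R, 0 < c &
  forall E y (rho r k : R) u, open E -> DG_neg p gamma E u ->
    {ae mu, forall x, E x -> 0 <= u x} ->
    0 < rho -> rho < r -> 0 < k -> cube y r `<=` E ->
    ((k `^ tau)%:E * \int[mu]_(x in cube y r) (u x `^ tau)%:E^-1 <=
      (c * (r - rho) ^+ N)%:E)%E ->
    {ae mu, forall x, cube y rho x -> k / 2 <= u x}.
Proof.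
move=> p1 gamma0 tau0; have p0 : 0 < p := lt_trans ltr01 p1.
have [c0 c00 H] := @inf_critical R N p gamma p1 gamma0.
exists c0 => // E y rho r k u oE dg u_ge0 rho0 rr k0 rE uI.
apply: (H E y rho r k u) => //.
have mE := open_measurable_rV oE; have mcube := measurable_cube y r.
have mu_ : measurable_fun (cube y r) u by apply: measurable_funS dg.1.1.1.
have inv0 x : (0 <= (u x `^ tau)%:E^-1)%E by rewrite inve_ge0 lee_fin powR_ge0.
have kp0 : (0 <= (k `^ p)%:E :> \bar R)%E by rewrite lee_fin powR_ge0.
have kt0 : (0 <= (k `^ tau)%:E :> \bar R)%E by rewrite lee_fin powR_ge0.
rewrite (_ : c0 * _ * _ = k `^ p * (c0 * (r - rho) ^+ N)); last by ring.
rewrite EFinM; apply: le_trans (lee_wpmul2l kp0 uI).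
rewrite muleA -EFinM -ge0_integralZl//; last 2 first.
- exact: measurable_powR_inve.
- by rewrite lee_fin mulr_ge0// powR_ge0.
apply: ae_ge0_le_integral => //.
- by move=> x _; rewrite lee_fin powR_ge0.
- apply: measurable_powR_fun; rewrite (_ : (fun x => _) =
    (fun x => u x - k)^\-).
    by apply: measurable_funS (Caccioppoli_measurable (dg.2 k)).
  by apply/funext => x; rewrite /funrneg opprB.
- by move=> x _; rewrite mule_ge0// lee_fin mulr_ge0// powR_ge0.
- by apply: measurable_funeM; exact: measurable_powR_inve.
apply: filterS u_ge0 => x ux xc; have {ux}u0 := ux (rE _ xc).
case: (leP (k - u x) 0) => [_|uk].
  by rewrite powR0 ?gt_eqF// mule_ge0// lee_fin mulr_ge0// powR_ge0.
rewrite subr_gt0 in uk.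
apply: (@le_trans _ _ (k `^ p)%:E).
  rewrite lee_fin; apply: ge0_ler_powR; rewrite ?nnegrE ?subr_ge0 ?(ltW p0)
    ?(ltW k0) ?(ltW uk)//.
  by rewrite gerBl.
rewrite inver; case: ifPn => [_|ut].
  by rewrite gt0_muley ?leey// lte_fin mulr_gt0// powR_gt0.
rewrite -EFinM lee_fin -mulrA ler_peMr ?powR_ge0//.
have ut0 : 0 < u x `^ tau by rewrite lt_neqAle eq_sym ut powR_ge0.
rewrite ler_pdivlMr// mul1r.
by apply: ge0_ler_powR; rewrite ?nnegrE ?(ltW tau0) ?(ltW k0) ?(ltW uk).
Qed.

End inf_bound.

Section conclusion.
Context {R : realType} {N : nat}.
Implicit Types (x y : 'rV[R]_N) (u : 'rV[R]_N -> R) (E : set 'rV[R]_N).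
Notation mu := (lebesgue_rV N).

Lemma ae_mrestr (D : set 'rV[R]_N) (mD : measurable D) (P : 'rV[R]_N -> Prop) :
  {ae mu, forall x, D x -> P x} -> {ae mrestr mu mD, forall x, P x}.
Proof.
move=> [A [mA A0 sA]]; exists (A `|` ~` D); split.
- by apply: measurableU => //; exact: measurableC.
- rewrite /mrestr setIUl setICl setU0; apply: (subset_measure0 _ mA) => //.
  exact: measurableI.
- move=> x nP; have [Dx|nDx] := pselect (D x); last by right.
  by left; apply: sA => /(_ Dx).
Qed.

Lemma avg_cubeE y (r : R) (f : 'rV[R]_N -> \bar R) : 0 < r ->
  avg_cube y r f = (((r *+ 2) ^+ N)^-1%:E * \int[mu]_(x in cube y r) f x)%E.
Proof.
move=> r0; rewrite /avg_cube lebesgue_rV_cube// inver gt_eqF//.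
by rewrite exprn_gt0// mulrn_wgt0.
Qed.

Lemma powR_root_product (q1 q2 q3 s : R) : 0 <= q1 -> 0 <= q2 -> 0 <= q3 ->
  0 < s ->
  (q1 `^ s^-1 * q2 `^ (N%:R * s^-1) * q3 `^ s^-1) `^ s = q1 * q2 ^+ N * q3.
Proof.
move=> q10 q20 q30 s0; have sn0 : s != 0 by rewrite gt_eqF.
rewrite powRM ?mulr_ge0 ?powR_ge0// powRM ?powR_ge0//
  -!powRrM -[_ * s^-1 * s]mulrA.
by rewrite mulVf// mulr1 !powRr1// powR_mulrn.
Qed.

(** The right-hand side is the smallest level that [sup_bound] admits; as this
    lemma requires a positive level, it is applied to k + e with e tending
    to 0. *)
Lemma sup_le_avg (p gamma sigma : R) : (0 < N)%N -> 1 < p -> 0 < gamma ->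
  0 < sigma ->
  exists2 C : R, 0 < C &
  forall E y (rho r : R) u, open E -> DG_pos p gamma E u ->
    0 < rho -> rho < r -> cube y r `<=` E ->
    (ess_sup_cube y rho u <= (C * (r / (r - rho)) `^ (N%:R * sigma^-1))%:E *
      avg_cube y r (fun x => (u x `^ sigma)%:E) `^ sigma^-1)%E.
Proof.
move=> N0 p1 gamma0 sigma0.
have [c c0 H] := sup_bound N0 p1 gamma0 sigma0.
exists ((2 ^+ N / c) `^ sigma^-1); first by rewrite powR_gt0// divr_gt0//
  exprn_gt0.
move=> E y rho r u oE dg rho0 rr rE; have r0 := lt_trans rho0 rr.
have rB0 : 0 < r - rho by rewrite subr_gt0.
rewrite avg_cubeE//.
have A0 : (0 <= \int[mu]_(x in cube y r) (u x `^ sigma)%:E)%E.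
  by apply: integral_ge0 => x _; rewrite lee_fin powR_ge0.
have V0 : 0 < (r *+ 2) ^+ N by rewrite exprn_gt0// mulrn_wgt0.
have D0 : 0 < (2 ^+ N / c) `^ sigma^-1 * (r / (r - rho)) `^ (N%:R * sigma^-1).
  by rewrite mulr_gt0// powR_gt0 ?divr_gt0// exprn_gt0.
move AE : (\int[mu]_(x in cube y r) (u x `^ sigma)%:E)%E A0 => A A0.
case: A A0 AE => [a a0 AE|_ _|//]; last first.
  rewrite gt0_muley ?lte_fin ?invr_gt0// poweRyr ?invr_eq0 ?gt_eqF//.
  by rewrite gt0_muley ?leey.
rewrite lee_fin in a0.
rewrite -EFinM.
set k := (X in (_ <= X%:E)%E).
have k_ge0 : 0 <= k by rewrite mulr_ge0 ?powR_ge0// ltW.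
have kE : c * k `^ sigma * (r - rho) ^+ N = a.
  rewrite /k powR_root_product ?divr_ge0 ?exprn_ge0 ?(ltW c0) ?(ltW r0)
    ?(ltW rB0)//; last first.
    by rewrite mulr_ge0// invr_ge0 ltW.
  rewrite -[r *+ 2]mulr_natl !exprMn exprVn; field.
  by rewrite !expf_neq0 ?gt_eqF.
apply/lee_addgt0Pr => e e0; rewrite -EFinD.
apply/ess_supP; apply: ae_mrestr.
have ke0 : 0 < k + e by rewrite ltr_wpDl.
have kI : (\int[mu]_(x in cube y r) (u x `^ sigma)%:E <=
    (c * (k + e) `^ sigma * (r - rho) ^+ N)%:E)%E.
  rewrite AE lee_fin -kE ler_wpM2r ?exprn_ge0 ?(ltW rB0)// ler_wpM2l
    ?(ltW c0)//.
  by apply: ge0_ler_powR; rewrite ?nnegrE ?(ltW sigma0) ?(ltW ke0) ?k_ge0//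
    lerDl ltW.
apply: filterS (H E y rho r (k + e) u oE dg rho0 rr ke0 rE kI) => x ux xc.
by rewrite lee_fin ux.
Qed.

(** The right-hand side is the inverse of half the largest level that
    [inf_bound] admits. If the average is 0, every level is admissible and the
    infimum is infinite; if it is infinite, so is the right-hand side. *)
Lemma inf_ge_avg (p gamma tau : R) : 1 < p -> 0 < gamma -> 0 < tau ->
  exists2 C : R, 0 < C &
  forall E y (rho r : R) u, open E -> DG_neg p gamma E u ->
    {ae mu, forall x, E x -> 0 <= u x} ->
    0 < rho -> rho < r -> cube y r `<=` E ->
    ((ess_inf_cube y rho u)^-1 <= (C * (r / (r - rho)) `^ (N%:R * tau^-1))%:E *
      avg_cube y r (fun x => (u x `^ tau)%:E^-1) `^ tau^-1)%E.
Proof.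
move=> p1 gamma0 tau0.
have [c c0 H] := @inf_bound R N p gamma tau p1 gamma0 tau0.
exists (2 * (2 ^+ N / c) `^ tau^-1).
  by rewrite mulr_gt0// powR_gt0// divr_gt0// exprn_gt0.
move=> E y rho r u oE dg u0 rho0 rr rE; have r0 := lt_trans rho0 rr.
have rB0 : 0 < r - rho by rewrite subr_gt0.
have rBN0 : 0 < (r - rho) ^+ N by rewrite exprn_gt0.
rewrite avg_cubeE//.
have A0 : (0 <= \int[mu]_(x in cube y r) (u x `^ tau)%:E^-1)%E.
  by apply: integral_ge0 => x _; rewrite inve_ge0 lee_fin powR_ge0.
have V0 : 0 < (r *+ 2) ^+ N by rewrite exprn_gt0// mulrn_wgt0.
have D0 : 0 < 2 * (2 ^+ N / c) `^ tau^-1 * (r / (r - rho)) `^ (N%:R * tau^-1).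
  by rewrite !mulr_gt0// powR_gt0 ?divr_gt0// exprn_gt0.
have I_ge k : 0 < k ->
    ((k `^ tau)%:E * \int[mu]_(x in cube y r) (u x `^ tau)%:E^-1 <=
      (c * (r - rho) ^+ N)%:E)%E -> ((k / 2)%:E <= ess_inf_cube y rho u)%E.
  move=> k0 kI; apply/ess_infP; apply: ae_mrestr.
  apply: filterS (H E y rho r k u oE dg u0 rho0 rr k0 rE kI) => x ux xc.
  by rewrite lee_fin ux.
move AE : (\int[mu]_(x in cube y r) (u x `^ tau)%:E^-1)%E A0 I_ge => A A0.
case: A A0 AE => [a a0 AE I_ge|_ _ _|//]; last first.
  rewrite gt0_muley ?lte_fin ?invr_gt0// poweRyr ?invr_eq0 ?gt_eqF//.
  by rewrite gt0_muley ?leey.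
rewrite lee_fin le_eqVlt in a0; case/predU1P : a0 => [a0|a0].
  have -> : ess_inf_cube y rho u = +oo%E.
    apply/eqyP => k k0; rewrite (le_trans _ (I_ge (2 * k) _ _)) ?mulr_gt0//.
      by rewrite mulrAC divff// mul1r.
    by rewrite -a0 mule0 lee_fin mulr_ge0// ltW.
  by rewrite invey mule_ge0 ?poweR_ge0// lee_fin ltW.
pose k := (c * (r - rho) ^+ N / a) `^ tau^-1.
have k0 : 0 < k by rewrite powR_gt0// divr_gt0// mulr_gt0.
have kI : ((k / 2)%:E <= ess_inf_cube y rho u)%E.
  apply: I_ge => //; rewrite -EFinM lee_fin /k -powRrM mulVf ?gt_eqF//.
  by rewrite powRr1 ?divfK ?gt_eqF// divr_ge0 ?mulr_ge0 ?(ltW c0) ?(ltW rBN0)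
    ?(ltW a0).
have k20 : 0 < k / 2 by rewrite divr_gt0.
apply: (@le_trans _ _ (k / 2)%:E^-1%E).
  by rewrite lee_pV2// ?inE ?lee_fin ?(ltW k20)// (le_trans _ kI)// lee_fin ltW.
rewrite inver gt_eqF// -EFinM lee_fin.
have kV : k^-1 = (a / (c * (r - rho) ^+ N)) `^ tau^-1.
  rewrite /k -[c * _ / a]invf_div powR_inv ?invrK//.
  by rewrite divr_ge0 ?mulr_ge0 ?(ltW c0) ?(ltW rBN0) ?(ltW a0).
rewrite invf_div mulrC -mulrA kV powRrM powR_mulrn ?divr_ge0 ?(ltW r0)
  ?(ltW rB0)//.
rewrite mulrC -!mulrA ler_pM2l//.
have r20 : 0 <= r *+ 2 by rewrite mulrn_wge0// ltW.
rewrite -!powRM ?mulr_ge0 ?invr_ge0 ?exprn_ge0 ?r20 ?divr_ge0 ?(ltW c0)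
  ?(ltW r0) ?(ltW rB0) ?(ltW V0) ?(ltW a0)//.
rewrite le_eqVlt; apply/orP; left; apply/eqP; congr (_ `^ _).
rewrite -[r *+ 2]mulr_natl !exprMn !exprVn; field.
by rewrite !expf_neq0 ?gt_eqF.
Qed.

Lemma ess_sup_cube_ge0 E y (rho : R) u : 0 < rho -> cube y rho `<=` E ->
  {ae mu, forall x, E x -> 0 <= u x} -> (0 <= ess_sup_cube y rho u)%E.
Proof.
move=> rho0 rE u0.
rewrite -(@ess_sup_cst _ _ _ (mrestr mu (measurable_cube y rho)) 0%E);
  last first.
  rewrite -[X in (_ < X)%E]/(mu (setT `&` cube y rho)) setTI.
  rewrite lebesgue_rV_cube// lte_fin exprn_gt0//.
  by rewrite mulrn_wgt0.
apply: le_ess_sup; apply: ae_mrestr.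
by apply: filterS u0 => x ux xc /=; rewrite lee_fin ux//; exact: rE.
Qed.

Lemma ess_inf_cube_ge0 E y (rho : R) u : cube y rho `<=` E ->
  {ae mu, forall x, E x -> 0 <= u x} -> (0 <= ess_inf_cube y rho u)%E.
Proof.
move=> rE u0; apply/ess_infP; apply: ae_mrestr.
by apply: filterS u0 => x ux xc /=; rewrite lee_fin ux//; exact: rE.
Qed.

End conclusion.

Unset Implicit Arguments.
Set Strict Implicit.
Set Printing Implicit Defensive.

(* In [\bar R], 1 / 0 = +oo and 0 * +oo = 0.  Hence u^-tau = +oo where u = 0,
   and sup u / inf u is +oo if inf u = 0 < sup u; it is 0 in the degenerate
   case where u vanishes a.e. on the smaller cube. *)
Theorem proposition2p1 (R : realType) (N : nat) (hN : (0 < N)%N)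
    (p gamma : R) (hp : 1 < p) (hgamma : 0 < gamma) :
  exists C_sup C_inf : R -> R,
    [/\ forall sigma, 0 < sigma -> 0 < C_sup sigma,
        forall tau, 0 < tau -> 0 < C_inf tau &
        forall (sigma tau : R), 0 < sigma -> 0 < tau ->
        forall (E : set 'rV[R]_N), open E ->
        forall (u : 'rV[R]_N -> R), DG p gamma E u ->
        {ae lebesgue_rV N, forall x, E x -> 0 <= u x} ->
        forall (y : 'rV[R]_N) (rho r : R), 0 < rho -> rho < r ->
        cube y r `<=` E ->
        (ess_sup_cube y rho u / ess_inf_cube y rho u <=
         (C_sup sigma * C_inf tau
            * (r / (r - rho)) `^ (N%:R * (sigma^-1 + tau^-1)))%:E
         * avg_cube y r (fun x => (u x `^ sigma)%:E) `^ sigma^-1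
         * avg_cube y r (fun x => ((u x `^ tau)%:E)^-1) `^ tau^-1)%E].
Proof.
have /choice[C_sup HC] sigma : exists C, 0 < sigma ->
    0 < C /\ forall E y (rho r : R) (u : 'rV[R]_N -> R), open E ->
    DG_pos p gamma E u -> 0 < rho -> rho < r -> cube y r `<=` E ->
    (ess_sup_cube y rho u <= (C * (r / (r - rho)) `^ (N%:R * sigma^-1))%:E *
      avg_cube y r (fun x => (u x `^ sigma)%:E) `^ sigma^-1)%E.
  have [sigma0|] := boolP (0 < sigma); last by exists 0.
  by have [C C0 HC] := @sup_le_avg R N p gamma sigma hN hp hgamma sigma0;
    exists C.
have /choice[C_inf HI] tau : exists C, 0 < tau ->
    0 < C /\ forall E y (rho r : R) (u : 'rV[R]_N -> R), open E ->
    DG_neg p gamma E u -> {ae lebesgue_rV N, forall x, E x -> 0 <= u x} ->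
    0 < rho -> rho < r -> cube y r `<=` E ->
    ((ess_inf_cube y rho u)^-1 <= (C * (r / (r - rho)) `^ (N%:R * tau^-1))%:E *
      avg_cube y r (fun x => (u x `^ tau)%:E^-1) `^ tau^-1)%E.
  have [tau0|] := boolP (0 < tau); last by exists 0.
  by have [C C0 HC'] := @inf_ge_avg R N p gamma tau hp hgamma tau0; exists C.
exists C_sup, C_inf; split.
- by move=> sigma /HC[].
- by move=> tau /HI[].
move=> sigma tau sigma0 tau0 E oE u [dgp dgn] u0 y rho r rho0 rr rE.
have [_ /(_ E y rho r u oE dgp rho0 rr rE) Hsup] := HC _ sigma0.
have [_ /(_ E y rho r u oE dgn u0 rho0 rr rE) Hinf] := HI _ tau0.
have rhoE : cube y rho `<=` E by apply: subset_trans rE; apply: cubeS;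
  exact: ltW.
have S0 := ess_sup_cube_ge0 rho0 rhoE u0.
have I0 : (0 <= (ess_inf_cube y rho u)^-1)%E.
  by rewrite inve_ge0; exact: ess_inf_cube_ge0 rhoE u0.
apply: le_trans (lee_pmul S0 I0 Hsup Hinf) _.
rewrite muleACA -EFinM muleA.
have X0 : 0 < r / (r - rho) by rewrite divr_gt0 ?subr_gt0// (lt_trans rho0).
by rewrite mulrACA -powRD_gt0// -mulrDr.
Qed.
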